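(* Let $n$ be a positive integer and let $a_1, \dots, a_n$ be square-free integers $\geq 2$ that are pairwise coprime and all of whose prime factors are congruent to $1$ modulo $4$. Then $$\dim_{\mathbb{F}_2} \mathrm{Cl}^{+}(\mathbb{Q}(\sqrt{a_1}, \dots, \sqrt{a_n}))[2] \leq \omega(a_1 \cdots a_n) \cdot 2^{n-1} - 2^n + 1.$$
   Context: For a number field $K$, $\mathrm{Cl}^{+}(K)$ denotes the narrow class group of $K$ and $\mathrm{Cl}^{+}(K)[2]$ its $2$-torsion subgroup. For a positive integer $m$, $\omega(m)$ denotes the number of distinct prime factors of $m$. *)

(* Defs.v *)
From mathcomp Require Import all_boot all_order all_algebra all_field.
Set Implicit Arguments. Unset Strict Implicit. Unset Printing Implicit Defensive.
Import Order.TTheory GRing.Theory Num.Theory.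
Local Open Scope ring_scope.

(* All number fields are realised inside algC (algebraic closure of Q). *)

Definition squarefree_nat (m : nat) : Prop :=
  forall p : nat, prime p -> ~~ (p * p %| m)%N.

Definition omega (m : nat) : nat := size (primes m).

Definition is_subfield (F : algC -> Prop) : Prop :=
  [/\ F 0 /\ F 1,
      (forall x y, F x -> F y -> F (x + y)),
      (forall x, F x -> F (- x)),
      (forall x y, F x -> F y -> F (x * y)) &
      (forall x, F x -> F (x^-1))].

Definition multiquad (n : nat) (a : 'I_n -> nat) (x : algC) : Prop :=
  forall F : algC -> Prop, is_subfield F ->
    (forall i, F (sqrtC (a i)%:R)) -> F x.

Definition ring_of_integers (K : algC -> Prop) (x : algC) : Prop :=
  K x /\ x \in Aint.

(* totally positive: positive under every embedding; every embedding of a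
   number field into algC extends to a ring endomorphism of algC *)
Definition totally_positive (x : algC) : Prop :=
  forall s : {rmorphism algC -> algC}, 0 < s x.

Definition nz_ideal (K : algC -> Prop) (I : algC -> Prop) : Prop :=
  [/\ (forall x, I x -> ring_of_integers K x),
      I 0,
      (forall x y, I x -> I y -> I (x + y)),
      (forall r x, ring_of_integers K r -> I x -> I (r * x)) &
      (exists x, I x /\ x != 0)].

Definition ideal_mul (I J : algC -> Prop) (z : algC) : Prop :=
  exists s : seq (algC * algC),
    (forall p, p \in s -> I p.1 /\ J p.2) /\ z = \sum_(p <- s) p.1 * p.2.

Definition narrow_equiv (K : algC -> Prop) (I J : algC -> Prop) : Prop :=
  exists l : algC, [/\ K l, totally_positive l &
    forall x, J x <-> exists y, I y /\ x = l * y].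

Definition narrow_2torsion (K : algC -> Prop) (I : algC -> Prop) : Prop :=
  exists alpha : algC, [/\ K alpha, totally_positive alpha &
    forall z, ideal_mul I I z <-> exists y, ring_of_integers K y /\ z = alpha * y].

(* dim_{F_2} Cl^+(K)[2] <= d, expressed as #Cl^+(K)[2] <= 2^d (the group is
   elementary abelian of exponent 2): any family of pairwise narrowly
   inequivalent nonzero integral ideals whose classes lie in Cl^+(K)[2]
   has at most 2^d members (every class contains an integral ideal). *)
Definition dim_narrow_cl2_le (K : algC -> Prop) (d : nat) : Prop :=
  forall (m : nat) (I : 'I_m -> (algC -> Prop)),
    (forall k, nz_ideal K (I k) /\ narrow_2torsion K (I k)) ->
    (forall k l, k != l -> ~ narrow_equiv K (I k) (I l)) ->
    (m <= 2 ^ d)%N.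

(* Main.v *)
Require Import Defs.
From HB Require Import structures.
From mathcomp Require Import all_boot all_order all_algebra all_field.
From mathcomp Require Import boolp.
From mathcomp Require classical_sets.
From mathcomp Require Import ring zify.

Set Implicit Arguments.
Unset Strict Implicit.
Unset Printing Implicit Defensive.
Import Order.TTheory GRing.Theory Num.Theory.
Local Open Scope ring_scope.

(** Let [K] be the multiquadratic field, [E+] its group of totally positive units and [S] the group
    of totally positive [x] in [K] whose principal ideal is a square, modulo squares of totally
    positive elements.  Sending an ideal [I] with [I ^ 2 = (alpha)] to [alpha] gives
    [#Cl+(K)[2] * #(E+ / E+ ^ 2) = #S].

    Upper bound for [S], by induction along [L = K(sqrt a)]: the norm maps [S_L] to [S_K], and if
    [N x = m ^ 2] with [m] totally positive then [x * (Tr x + 2 m) = (x + m) ^ 2], so the kernel is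
    represented by elements of [K], which lie in [S_K] up to the parities of their valuations at
    the at most [omega a * 2 ^ n] primes of [K] above [a].  This gives
    [#S <= 2 ^ (omega (a_1 ... a_n) * 2 ^ (n - 1))].

    Lower bound for units: each of the [2 ^ n - 1] quadratic subfields contributes a totally
    positive unit of norm 1 (Pell) that is not a square there; the isotypic projections of
    the Galois group separate them, whence [#(E+ / E+ ^ 2) >= 2 ^ (2 ^ n - 1)].

    Valuations are read off a valuation ring of [algC] above each prime [l]; its conjugates give all
    the places of [K] above [l]. *)

(** * Places of the algebraic numbers *)

(** No ideal is ever factored. A prime above l enters only through a valuation ring of [algC], whose
    value group is divisible; valuations are therefore measured against that of l, and the
    ramification index, 1 or 2, decides what an even valuation means. Since every a_i is 1 modulo 4,
    the prime 2 stays unramified, and only the divisors of the a_i enter the count.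

    Neither the finiteness of the class group nor the structure of the unit group is an input: E+ /
    E+ ^ 2 is finite because it embeds in S, and a maximal family of inequivalent units then
    realises its index exactly.

    The isotypic projections are integral only after scaling by 2 ^ n, so they do not separate units
    modulo squares directly. The loss is bounded: comparing units modulo powers of exponent 2 ^ (n +
    m) and letting m grow removes it. Total positivity makes the cancellation of exponents
    legitimate, since positive roots are unique. *)

Definition subring_over_Aint (R : algC -> Prop) : Prop :=
  [/\ forall x, x \in Aint -> R x,
      forall x y, R x -> R y -> R (x - y) &
      forall x y, R x -> R y -> R (x * y)].

Definition is_place (l : nat) (O : algC -> Prop) : Prop :=
  [/\ subring_over_Aint O, ~ O l%:R^-1 & forall x, O x \/ O x^-1].

Lemma subring_add R x y : subring_over_Aint R -> R x -> R y -> R (x + y).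
Proof.
move=> [RA RB _] Rx Ry; rewrite -[y]opprK; apply: (RB) => //.
by rewrite -sub0r; apply: RB => //; apply/RA/Aint0.
Qed.

Lemma subring_sum R (I : Type) (r : seq I) (P : pred I) (F : I -> algC) :
  subring_over_Aint R -> (forall i, P i -> R (F i)) -> R (\sum_(i <- r | P i) F i).
Proof.
move=> HR RF; apply: big_ind => //; last by move=> x y; apply: subring_add.
by case: HR => RA _ _; apply/RA/Aint0.
Qed.

Lemma subring_exp R x k : subring_over_Aint R -> R x -> R (x ^+ k).
Proof.
move=> [RA _ RM] Rx; elim: k => [|k IH]; first exact/RA/Aint1.
by rewrite exprS; apply: RM.
Qed.

Lemma Aint_nat n : n%:R \in Aint.
Proof. by apply: Aint_Cnat; rewrite natr_nat. Qed.

Lemma natV_notin_Aint l : (1 < l)%N -> (l%:R^-1 : algC) \notin Aint.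
Proof.
move=> l1; apply/negP => lA.
have l0 : (l%:R : algC) != 0 by rewrite pnatr_eq0 -lt0n ltnW.
have : (l%:R^-1 : algC) \in Num.int by apply: Cint_rat_Aint lA; rewrite rpredV rpred_nat.
case/intrP => z zE.
have : (l%:R : algC) * z%:~R = 1 by rewrite -zE divff.
rewrite -[l%:R]/((Posz l)%:~R) -intrM => /eqP; rewrite -[1]/(1%:~R) eqr_int => /eqP /(congr1 absz).
by rewrite abszM /= => /eqP; rewrite muln_eq1 => /andP[/eqP l1' _]; rewrite l1' in l1.
Qed.

Definition adjoin_ring (R : algC -> Prop) (x y : algC) : Prop :=
  exists2 p : {poly algC}, (forall i, R p`_i) & y = p.[x].

Lemma adjoin_subring R x : subring_over_Aint R -> subring_over_Aint (adjoin_ring R x).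
Proof.
move=> HR; have [RA RB RM] := HR; split.
- move=> y /RA Ry; exists y%:P; last by rewrite hornerC.
  by move=> i; rewrite coefC; case: ifP => // _; apply/RA/Aint0.
- move=> _ _ [p Rp ->] [q Rq ->]; exists (p - q); last by rewrite hornerD hornerN.
  by move=> i; rewrite coefB; apply: RB.
- move=> _ _ [p Rp ->] [q Rq ->]; exists (p * q); last by rewrite hornerM.
  by move=> i; rewrite coefM; apply: subring_sum => // j _; apply: RM.
Qed.

(* Maximality among the subrings that avoid [1/l] forces the valuation property. *)
Definition maximal_avoiding (l : nat) (R : algC -> Prop) : Prop :=
  [/\ subring_over_Aint R, ~ R l%:R^-1 &
      forall x, ~ R x -> adjoin_ring R x l%:R^-1].

Lemma maximal_avoiding_exists l : (1 < l)%N -> exists R, maximal_avoiding l R.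
Proof.
move=> l1.
pose P (X : classical_sets.set algC) :=
  (forall x, ~ X x) \/ (subring_over_Aint X /\ ~ X l%:R^-1).
have [|A [PA maxA]] := @classical_sets.Zorn_bigcup algC P.
  move=> F FP Ftot.
  have [[X FX [x Xx]]|Fempty] := EM (exists2 X, F X & exists x, X x); last first.
    by left=> x [X FX Xx]; apply: Fempty; exists X => //; exists x.
  have sub Y y : F Y -> Y y -> subring_over_Aint Y /\ ~ Y l%:R^-1.
    by move=> /FP[/(_ y)//|].
  right; split; last by move=> [Y FY Yl]; have [_] := sub _ _ FY Yl.
  have common y z Y Z : F Y -> F Z -> Y y -> Z z ->
      exists W, [/\ F W, subring_over_Aint W, W y & W z].
    move=> FY FZ Yy Zz; have [YZ|ZY] := Ftot _ _ FY FZ.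
      by exists Z; have [? _] := sub _ _ FZ Zz; split=> //; apply: YZ.
    by exists Y; have [? _] := sub _ _ FY Yy; split=> //; apply: ZY.
  split.
  - by move=> y yA; exists X => //; have [[XA _ _] _] := sub _ _ FX Xx; apply: XA.
  - move=> y z [Y FY Yy] [Z FZ Zz]; have [W [FW [_ WB _] Wy Wz]] := common _ _ _ _ FY FZ Yy Zz.
    by exists W => //; apply: WB.
  - move=> y z [Y FY Yy] [Z FZ Zz]; have [W [FW [_ _ WM] Wy Wz]] := common _ _ _ _ FY FZ Yy Zz.
    by exists W => //; apply: WM.
have AintP : subring_over_Aint (fun x => x \in Aint).
  by split=> // x y xA yA; [apply: rpredB|apply: rpredM].
have lA := natV_notin_Aint l1.
case: PA => [Aempty|[HA Al]].
  exfalso; apply: (maxA (fun x => x \in Aint)); last by right; split=> //; apply/negP.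
  split; first by move=> x /Aempty.
  by move=> /(_ 0 Aint0) /Aempty.
exists A; split=> // x Ax; apply: contrapT => Axl.
apply: (maxA (adjoin_ring A x)); last by right; split=> //; apply: adjoin_subring.
have [AA AB AM] := HA.
split.
  move=> y Ay; exists y%:P; last by rewrite hornerC.
  by move=> i; rewrite coefC; case: ifP => // _; apply/AA/Aint0.
move=> sub; apply/Ax/sub; exists 'X; last by rewrite hornerX.
by move=> i; rewrite coefX; case: eqP => _; [apply/AA/Aint1|apply/AA/Aint0].
Qed.

Lemma horner_inv_rev (F : fieldType) (q : {poly F}) m (x : F) : x != 0 -> size q = m.+1 ->
  x ^+ m * q.[x^-1] = q`_0 * x ^+ m + \sum_(i < m) q`_(m - i) * x ^+ i.
Proof.
move=> x0 qE; rewrite horner_coef qE big_ord_recl /= expr0 mulr1 mulrDr mulrC; congr (_ + _).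
rewrite (reindex_inj rev_ord_inj) mulr_sumr; apply: eq_bigr => i _ /=.
rewrite /bump /= add1n subnSK // mulrCA exprVn; congr (_ * _).
by rewrite -expfB_cond ?subKn ?(negPf x0) ?add0n ?leq_subr // ltnW.
Qed.

(** In other words l lies in the Jacobson radical of [R]. If the inverse of x = 1 - l s were
    missing, 1/l would be a polynomial in it, so x^k / l would lie in [R] for some k; as x^k = 1 - l
    t, so would 1/l. *)
Lemma maximal_avoiding_unit l R s : (1 < l)%N -> maximal_avoiding l R -> R s ->
  R (1 - l%:R * s)^-1 /\ 1 - l%:R * s != 0.
Proof.
move=> l1 [HR Rl maxR] Rs; have [RA RB RM] := HR.
have l0 : (l%:R : algC) != 0 by rewrite pnatr_eq0 -lt0n ltnW.
set x := 1 - _.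
have x0 : x != 0.
  apply/eqP => /eqP; rewrite subr_eq0 => /eqP E; apply: Rl.
  by have -> : l%:R^-1 = s by apply: (mulfI l0); rewrite divff.
split=> //; apply: contrapT => /maxR[p Rp pE].
have Rx : R x by apply: RB; [apply/RA/Aint1|apply: RM => //; apply/RA/Aint_nat].
have p0 : (0 < size p)%N.
  rewrite lt0n size_poly_eq0; apply/eqP => p0; move: pE; rewrite p0 horner0 => /eqP.
  by rewrite invr_eq0 (negPf l0).
have Rxl : R (x ^+ (size p).-1 * l%:R^-1).
  rewrite pE horner_inv_rev ?prednK //.
  apply: subring_add => //; first by apply: RM => //; apply: subring_exp.
  by apply: subring_sum => // i _; apply: RM => //; apply: subring_exp.
have [t Rt tE] : exists2 t, R t & x ^+ (size p).-1 = 1 - l%:R * t.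
  elim: (_.-1) => [|k [t Rt tE]]; first by exists 0; [apply/RA/Aint0|rewrite expr0; ring].
  exists (t + s - l%:R * t * s); last by rewrite exprS tE /x; ring.
  apply: RB; first exact: subring_add.
  by apply: (RM) => //; apply: RM => //; apply/RA/Aint_nat.
apply: Rl; have -> : (l%:R^-1 : algC) = x ^+ (size p).-1 * l%:R^-1 + t.
  by rewrite tE; field.
exact: subring_add.
Qed.

(** Chevalley's argument: if both x and 1/x were missing, 1/l would be a polynomial in each of them,
    and the longer of two such expressions can always be shortened with the help of the other. *)
Lemma maximal_avoiding_valuation l R x : (1 < l)%N -> maximal_avoiding l R -> R x \/ R x^-1.
Proof.
move=> l1 maxR; have [HR Rl adjR] := maxR; have [RA RB RM] := HR.
have l0 : (l%:R : algC) != 0 by rewrite pnatr_eq0 -lt0n ltnW.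
have R0 : R 0 by apply/RA/Aint0.
suff descent N (y : algC) (p q : {poly algC}) : (size p + size q <= N)%N -> y != 0 ->
    (forall i, R p`_i) -> (forall i, R q`_i) ->
    l%:R^-1 = p.[y] -> l%:R^-1 = q.[y^-1] -> False.
  have [->|x0] := eqVneq x 0; first by left.
  apply: contrapT => /not_orP[/adjR[p Rp pE] /adjR[q Rq qE]].
  exact: (descent _ x p q (leqnn _)).
elim: N y p q => [|N IH] y p q szN y0 Rp Rq pE qE.
  move: szN pE; rewrite leqn0 addn_eq0 size_poly_eq0 => /andP[/eqP -> _].
  by rewrite horner0 => /eqP; rewrite invr_eq0 (negPf l0).
wlog le_qp : y y0 p q szN Rp Rq pE qE / (size q <= size p)%N.
  move=> W; case: (leqP (size q) (size p)) => [le|/ltnW le]; first exact: (W y y0 p q).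
  by apply: (W y^-1 _ q p) => //; rewrite ?invr_eq0 ?invrK // addnC.
case Em : (size q) => [|m].
  move/eqP: Em qE; rewrite size_poly_eq0 => /eqP ->.
  by rewrite horner0 => /eqP; rewrite invr_eq0 (negPf l0).
case En : (size p) => [|n]; first by rewrite En Em in le_qp.
have le_mn : (m <= n)%N by rewrite -ltnS -Em -En.
have [Ru u0] := maximal_avoiding_unit l1 maxR (Rq 0).
set u := 1 - _ in Ru u0.
(* Multiplying 1 = l q(1/y) by y^m and collecting y^m on the left gives y^m = l h(y) with h of
   degree below m; substituted in the leading term of p, this lowers the degree of p. *)
pose h := \poly_(i < m) (u^-1 * q`_(m - i)).
have Rh i : R h`_i by rewrite coef_poly; case: ifP => // _; apply: RM.
have hE : y ^+ m = l%:R * h.[y].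
  have := horner_inv_rev y0 Em; rewrite -qE => E.
  rewrite horner_poly (eq_bigr (fun i : 'I_m => u^-1 * (q`_(m - i) * y ^+ i))); last first.
    by move=> i _; rewrite mulrA.
  rewrite -mulr_sumr; set S := \sum_(i < m) _ in E *.
  have -> : S = y ^+ m * l%:R^-1 - q`_0 * y ^+ m by rewrite E addrC addKr.
  by apply: (mulfI u0); rewrite mulrCA mulVKf // /u; field.
pose p2 := \poly_(i < n) p`_i + (p`_n * l%:R)%:P * ('X^(n - m) * h).
apply: (IH y p2 q) => //.
- have szp2 : (size p2 <= n)%N.
    apply/leq_sizeP => i le_ni; rewrite coefD coef_poly ltnNge le_ni add0r.
    rewrite coefCM coefXnM coef_poly; case: ifP => [_|/negbT]; first by rewrite mulr0.
    by rewrite -leqNgt => le; rewrite ltnNge leq_subRL ?subnK // le_ni mulr0.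
  by rewrite -ltnS (leq_trans _ szN) // ltn_add2r En ltnS.
- move=> i; rewrite coefD coef_poly coefCM coefXnM; apply: subring_add => //.
    by case: ifP.
  by apply: (RM); [apply: RM => //; apply/RA/Aint_nat|case: ifP].
rewrite hornerD hornerM hornerC hornerM hornerXn horner_poly pE horner_coef En big_ord_recr /=.
by rewrite -(subnK le_mn) exprD hE addnK; ring.
Qed.

Lemma place_exists l : (1 < l)%N -> exists O, is_place l O.
Proof.
move=> l1; have [R maxR] := maximal_avoiding_exists l1; exists R.
by case: (maxR) => HR Rl _; split=> // x; apply: maximal_avoiding_valuation maxR.
Qed.

(** * Units and valuations at a place *)

Definition vunit (O : algC -> Prop) (x : algC) : Prop := [/\ x != 0, O x & O x^-1].

(** With v the valuation of [O], this says that v(x) is an integral multiple of v(l); [veven] asks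
    for an even multiple. *)
Definition vint (l : nat) (O : algC -> Prop) (x : algC) : Prop :=
  exists k : int, vunit O (x * l%:R ^ k).

Definition veven (l : nat) (O : algC -> Prop) (x : algC) : Prop :=
  exists k : int, vunit O (x * l%:R ^ (k + k)).

Lemma place_Aint l O x : is_place l O -> x \in Aint -> O x.
Proof. by case=> -[OA _ _] _ _; apply: OA. Qed.

Lemma place_mul l O x y : is_place l O -> O x -> O y -> O (x * y).
Proof. by case=> -[_ _ OM] _ _; apply: OM. Qed.

Lemma place_add l O x y : is_place l O -> O x -> O y -> O (x + y).
Proof. by case=> HO _ _; apply: subring_add. Qed.

Lemma place_opp l O x : is_place l O -> O x -> O (- x).
Proof. by case=> -[OA OB _] _ _ Ox; rewrite -sub0r; apply: OB => //; apply/OA/Aint0. Qed.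

Lemma vunit1 l O : is_place l O -> vunit O 1.
Proof. by move=> HO; split; rewrite ?oner_eq0 ?invr1 //; apply: place_Aint HO Aint1. Qed.

Lemma vunitM l O x y : is_place l O -> vunit O x -> vunit O y -> vunit O (x * y).
Proof.
move=> HO [x0 Ox Ox'] [y0 Oy Oy']; split; first by rewrite mulf_neq0.
  exact: place_mul HO _ _.
by rewrite invfM; apply: place_mul HO _ _.
Qed.

Lemma vunitV O x : vunit O x -> vunit O x^-1.
Proof. by move=> [x0 Ox Ox']; split; rewrite ?invr_eq0 ?invrK. Qed.

Lemma vunitN l O x : is_place l O -> vunit O x -> vunit O (- x).
Proof.
move=> HO [x0 Ox Ox']; split; rewrite ?oppr_eq0 ?invrN //.
  exact: place_opp HO _.
exact: place_opp HO _.
Qed.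

Lemma vunit_mulr l O x y : is_place l O -> O x -> O y -> vunit O (x * y) -> vunit O y.
Proof.
move=> HO Ox Oy [xy0 _ Oxy]; have [x0 y0] : x != 0 /\ y != 0.
  by apply/andP; rewrite -negb_or -mulf_eq0.
split=> //; have -> : y^-1 = x * (x * y)^-1 by field; rewrite x0 y0.
exact: place_mul HO _ _.
Qed.

Lemma vunit_sqr l O x : is_place l O -> vunit O (x ^+ 2) -> vunit O x.
Proof.
move=> HO [x20 Ox2 Ox2']; have x0 : x != 0 by rewrite sqrf_eq0 in x20.
have [_ _ /(_ x)[Ox|Ox']] := HO; split=> //.
  have -> : x^-1 = x * (x ^+ 2)^-1 by field.
  exact: place_mul HO _ _.
have -> : x = x ^+ 2 * x^-1 by field.
exact: place_mul HO _ _.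
Qed.

(** A valuation ring is local: whichever of x and y divides the other also divides the unit x +
    y. *)
Lemma vunit_add l O x y : is_place l O -> O x -> O y -> vunit O (x + y) ->
  vunit O x \/ vunit O y.
Proof.
move=> HO Ox Oy Uxy.
have [x0|x0] := eqVneq x 0; first by right; rewrite x0 add0r in Uxy.
have [y0|y0] := eqVneq y 0; first by left; rewrite y0 addr0 in Uxy.
have O1 := place_Aint HO Aint1.
have [_ _ /(_ (x / y))[Oxy|]] := HO; last rewrite invf_div => Oyx.
  right; apply: (vunit_mulr HO (x := x / y + 1)) => //; first exact: place_add HO _ _.
  by have -> : (x / y + 1) * y = x + y by field.
left; apply: (vunit_mulr HO (x := 1 + y / x)) => //; first exact: place_add HO _ _.
by have -> : (1 + y / x) * x = x + y by field.
Qed.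

Lemma vunit_1pm l O x : is_place l O -> O x -> ~ vunit O x ->
  vunit O (1 + x) /\ vunit O (1 - x).
Proof.
move=> HO Ox Ux; have O1 := place_Aint HO Aint1; have ONx := place_opp HO Ox.
split.
  have U : vunit O (1 + x + - x) by rewrite addrK; apply: vunit1 HO.
  have [//|/(vunitN HO)] := vunit_add HO (place_add HO O1 Ox) ONx U.
  by rewrite opprK.
have U : vunit O (1 - x + x) by rewrite subrK; apply: vunit1 HO.
by have [] := vunit_add HO (place_add HO O1 ONx) Ox U.
Qed.

Lemma vunit_nat l O m : prime l -> is_place l O -> coprime m l -> vunit O m%:R.
Proof.
move=> l_pr HO co; have l0 : (l%:R : algC) != 0 by rewrite pnatr_eq0 -lt0n prime_gt0.
have [Ol Om] : O l%:R /\ O m%:R by split; apply: place_Aint HO (Aint_nat _).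
have Ul : ~ vunit O l%:R by case: HO => _ Ol' _ [].
have m0 : (0 < m)%N.
  by case: m co {Om} => [|//]; rewrite /coprime gcd0n => /eqP E; rewrite E in l_pr.
have [u v uv _] := @egcdnP m l m0; rewrite (eqP co) in uv.
have Ok k : O k%:R by apply: place_Aint HO (Aint_nat _).
have U1 : vunit O (- (v%:R * l%:R) + u%:R * m%:R).
  by rewrite -!natrM uv natrD addKr; apply: vunit1 HO.
have [] := vunit_add HO (place_opp HO (place_mul HO (Ok v) (Ok l))) (place_mul HO (Ok u) (Ok m)) U1.
  by move/(vunitN HO); rewrite opprK => /(vunit_mulr HO (Ok v) Ol).
by move/(vunit_mulr HO (Ok u) Om).
Qed.

Lemma place_expz_neq0 l (k : int) : prime l -> (l%:R : algC) ^ k != 0.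
Proof. by move=> l_pr; rewrite expfz_neq0 // pnatr_eq0 -lt0n prime_gt0. Qed.

Lemma vunit_expz l O (k : int) : prime l -> is_place l O -> vunit O (l%:R ^ k) -> k = 0.
Proof.
move=> l_pr HO; have l0 : (l%:R : algC) != 0 by rewrite pnatr_eq0 -lt0n prime_gt0.
have Ol : O l%:R by apply: place_Aint HO (Aint_nat _).
have Ul : ~ vunit O l%:R by case: HO => _ Ol' _ [].
have nat_case (n : nat) : vunit O (l%:R ^+ n) -> n = 0%N.
  case: n => // n; rewrite exprS mulrC => U; case: Ul; apply: (vunit_mulr HO _ _ U) => //.
  by case: HO => HO _ _; apply: subring_exp.
case: k => n; first by move/nat_case => ->.
by rewrite NegzE -invr_expz => /vunitV; rewrite invrK => /nat_case.
Qed.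

Lemma vintM l O x y : prime l -> is_place l O -> vint l O x -> vint l O y -> vint l O (x * y).
Proof.
move=> l_pr HO [j Uj] [k Uk]; exists (j + k).
rewrite expfzDr ?pnatr_eq0 -?lt0n ?prime_gt0 // mulrACA; exact: vunitM HO _ _.
Qed.

Lemma vintV l O x : vint l O x -> vint l O x^-1.
Proof. by move=> [k Uk]; exists (- k); rewrite -invr_expz -invfM; apply: vunitV. Qed.

Lemma vint_vunit l O x : vunit O x -> vint l O x.
Proof. by move=> Ux; exists 0; rewrite expr0z mulr1. Qed.

Lemma vint_sqr_veven l O x : prime l -> is_place l O -> vint l O x -> veven l O (x ^+ 2).
Proof.
move=> l_pr HO [k Uk]; exists k; rewrite expfzDr ?pnatr_eq0 -?lt0n ?prime_gt0 //.
by rewrite expr2 mulrACA; apply: vunitM HO _ _.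
Qed.

Lemma vevenM l O x y : prime l -> is_place l O ->
  veven l O x -> veven l O y -> veven l O (x * y).
Proof.
move=> l_pr HO [j Uj] [k Uk]; exists (j + k).
by rewrite addrACA expfzDr ?pnatr_eq0 -?lt0n ?prime_gt0 // mulrACA; apply: vunitM HO _ _.
Qed.

Lemma vevenV l O x : veven l O x -> veven l O x^-1.
Proof. by move=> [k Uk]; exists (- k); rewrite -opprD -invr_expz -invfM; apply: vunitV. Qed.

Lemma veven_vunit l O x : vunit O x -> veven l O x.
Proof. by move=> Ux; exists 0; rewrite addr0 expr0z mulr1. Qed.

Lemma vint_odd_mul l O x y : prime l -> is_place l O -> vint l O x -> vint l O y ->
  ~ veven l O x -> ~ veven l O y -> veven l O (x * y).
Proof.
move=> l_pr HO Vx Vy; have half z : vint l O z -> ~ veven l O z ->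
    exists k : int, vunit O (z * l%:R ^ (k + k + 1)).
  move=> [k Uk] nz; have : k = ((k %/ 2)%Z + (k %/ 2)%Z) + (k %% 2)%Z.
    by rewrite {1}(divz_eq k 2); ring.
  have : ((k %% 2)%Z == 0) || ((k %% 2)%Z == 1).
    have := ltz_pmod k (isT : 0 < 2 :> int); have := modz_ge0 k (isT : 2 != 0 :> int).
    by case: (k %% 2)%Z => // -[|[|]].
  case/orP => /eqP -> kE; rewrite kE in Uk; last by exists (k %/ 2)%Z.
  by case: nz; exists (k %/ 2)%Z; rewrite addr0 in Uk.
move=> /(half _ Vx)[j Uj] /(half _ Vy)[k Uk]; exists (j + k + 1).
have -> : j + k + 1 + (j + k + 1) = (j + j + 1) + (k + k + 1) by ring.
by rewrite expfzDr ?pnatr_eq0 -?lt0n ?prime_gt0 // mulrACA; apply: vunitM HO _ _.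
Qed.

(** * Quadratic extensions at a place *)

Lemma subfield_sub K x y : is_subfield K -> K x -> K y -> K (x - y).
Proof. by case=> _ KD KN _ _ Kx Ky; apply: KD => //; apply: KN. Qed.

Lemma subfield_div K x y : is_subfield K -> K x -> K y -> K (x / y).
Proof. by case=> _ _ _ KM KV Kx Ky; apply: KM => //; apply: KV. Qed.

Lemma subfield_nat K n : is_subfield K -> K n%:R.
Proof.
case=> -[K0 K1] KD _ _ _; elim: n => [//|n IH].
by rewrite -natr1; apply: KD.
Qed.

Lemma Aint_sqr x : x ^+ 2 \in Aint -> x \in Aint.
Proof.
rewrite unfold_in => Zp; have := root_minCpoly (x ^+ 2); have := minCpoly_monic (x ^+ 2).
move: (minCpoly _) Zp => p Zp p_mon rootp; apply: (@root_monic_Aint (p \Po 'X^2)).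
- by rewrite /root horner_comp hornerXn.
- by rewrite monicE lead_coef_comp ?size_polyXn // lead_coefXn expr1n mulr1 -monicE.
- apply/polyOverP => i; rewrite coef_comp_poly; apply: rpred_sum => j _.
  by rewrite -exprM coefXn rpredM ?rpred_nat //; apply/polyOverP.
Qed.

Lemma sqrtC_nat_Aint n : sqrtC n%:R \in Aint.
Proof. by apply: Aint_sqr; rewrite sqrtCK Aint_nat. Qed.

(* With [w = (1 + sqrt a) / 2] and conjugate [1 - w], write [z = X + Y w]; after scaling
   by the larger of [X], [Y], one of [z] and its conjugate is a unit since [2 w - 1 = sqrt a] is. *)
Lemma unramified_step l O K a x y : prime l -> is_place l O -> is_subfield K ->
  ~~ (l %| a)%N -> (a %% 4 = 1)%N -> K x -> K y -> x + y * sqrtC a%:R != 0 ->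
  exists z, [/\ K z, z != 0 & vunit O ((x + y * sqrtC a%:R) / z)].
Proof.
move=> l_pr HO HK la a4 Kx Ky; have [[K0 K1] KD KN KM KV] := HK.
set r := sqrtC _; pose w := (1 + r) / 2; pose w' := 1 - w.
pose c := (a %/ 4)%:R : algC.
have r2 : r ^+ 2 = 1 + c * 4.
  by rewrite sqrtCK {1}(divn_eq a 4) a4 natrD natrM addrC.
have cE : c = (r ^+ 2 - 1) / 4 by rewrite r2; field.
have O1 := place_Aint HO Aint1.
have [Oc Oa] : O c /\ O a%:R by split; apply: place_Aint HO (Aint_nat _).
have Ow : O w.
  have wE : w * w = w + c by rewrite cE /w; field.
  have [_ _ /(_ w)[//|Ow]] := HO.
  have [->|w0] := eqVneq w 0; first exact: place_Aint HO Aint0.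
  have -> : w = 1 + c * w^-1 by apply: (mulfI w0); rewrite wE; field.
  by apply: (place_add HO) => //; apply: place_mul HO _ _.
have Ow' : O w' by apply: (place_add HO) => //; apply: place_opp HO _.
have Ur : vunit O r.
  apply: (vunit_sqr HO); rewrite sqrtCK; apply: (vunit_nat l_pr HO).
  by rewrite coprime_sym prime_coprime.
have rE : r = w - w' by rewrite /w' /w; field.
pose X := x - y; pose Y := 2 * y.
have [KX KY] : K X /\ K Y.
  by split; [apply: subfield_sub|apply: KM => //; apply: subfield_nat].
have -> : x + y * r = X + Y * w by rewrite /X /Y /w; field.
have Nw t u : K t -> K u -> K ((t + u * w) * (t + u * w')).
  move=> Kt Ku; have -> : (t + u * w) * (t + u * w') = t * t + t * u - u * u * c.
    by rewrite cE /w' /w; field.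
  apply: subfield_sub => //; last by apply: (KM); [apply: (KM)|apply: subfield_nat].
  by apply: KD; apply: (KM).
(* When only the conjugate is a unit, dividing by the norm, an element of K, leaves the inverse of
   that conjugate. *)
have main s t u : K s -> K t -> K u -> s != 0 -> O t -> O u ->
    vunit O (t + u * w) \/ vunit O (t + u * w') -> s * (t + u * w) != 0 ->
    exists z, [/\ K z, z != 0 & vunit O (s * (t + u * w) / z)].
  move=> Ks Kt Ku s0 Ot Ou; rewrite mulf_eq0 negb_or => U /andP[_ z0].
  case: U => U; first by exists s; split=> //; rewrite mulrAC divff // mul1r.
  have [z'0 _ _] := U.
  exists (s * ((t + u * w) * (t + u * w'))); split.
  - by apply: KM => //; apply: Nw.
  - by rewrite !mulf_neq0.
  - have -> : s * (t + u * w) / (s * ((t + u * w) * (t + u * w'))) = (t + u * w')^-1.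
      by field; rewrite s0 z0 z'0.
    exact: vunitV.
move=> z0; have OA t u v : O t -> O u -> O v -> O (t + u * v).
  by move=> Ot Ou Ov; apply: (place_add HO) => //; apply: (place_mul HO).
have [_ _ /(_ (Y / X))[OYX|]] := HO; last rewrite invf_div => OXY.
  have [X0|X0] := eqVneq X 0.
    have Y0 : Y != 0 by apply: contra_neq z0 => ->; rewrite X0; ring.
    have zE : X + Y * w = Y * (0 + 1 * w) by rewrite X0; ring.
    rewrite zE; apply: main; rewrite -?zE //; first exact: place_Aint HO Aint0.
    have U : vunit O (w - w') by rewrite -rE.
    rewrite !add0r !mul1r; have [|/(vunitN HO)] := vunit_add HO Ow (place_opp HO Ow') U.
      by left.
    by rewrite opprK; right.
  have zE : X + Y * w = X * (1 + Y / X * w) by field.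
  rewrite zE; apply: main; rewrite -?zE //; first exact: subfield_div.
  (* This combination eliminates [Y / X] and leaves w' - w, the unit r up to sign, so one of the two
     factors must be a unit. *)
  have U : vunit O (w' * (1 + Y / X * w) - w * (1 + Y / X * w')).
    have -> : w' * (1 + Y / X * w) - w * (1 + Y / X * w') = - r by rewrite rE; ring.
    exact: vunitN HO _.
  case: (vunit_add HO (place_mul HO Ow' (OA _ _ _ O1 OYX Ow))
    (place_opp HO (place_mul HO Ow (OA _ _ _ O1 OYX Ow'))) U).
    by move/(vunit_mulr HO Ow' (OA _ _ _ O1 OYX Ow)); left.
  by move/(vunitN HO); rewrite opprK => /(vunit_mulr HO Ow (OA _ _ _ O1 OYX Ow')); right.
have [Y0|Y0] := eqVneq Y 0.
  exists X; rewrite Y0 mul0r addr0 in z0 *; split=> //; rewrite divff //; exact: vunit1 HO.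
have zE : X + Y * w = Y * (X / Y + 1 * w) by field.
rewrite zE; apply: main; rewrite -?zE //; first exact: subfield_div.
have U : vunit O (X / Y + 1 * w - (X / Y + 1 * w')).
  by have -> : X / Y + 1 * w - (X / Y + 1 * w') = r by rewrite rE; ring.
case: (vunit_add HO (OA _ _ _ OXY O1 Ow) (place_opp HO (OA _ _ _ OXY O1 Ow')) U).
  by left.
by move/(vunitN HO); rewrite opprK; right.
Qed.

(** Since l divides a exactly once, v(sqrt a) is half an odd multiple of v(l), whereas v(x) and v(y)
    are integral multiples. So x and y sqrt a have different valuations, and both the sum and the
    difference have the valuation of the dominant term. *)
Lemma ramified_step l O (K : algC -> Prop) a x y : prime l -> is_place l O ->
  (forall z, K z -> z != 0 -> vint l O z) -> (l %| a)%N -> ~~ (l * l %| a)%N ->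
  K x -> K y -> x + y * sqrtC a%:R != 0 ->
  [/\ x - y * sqrtC a%:R != 0, vunit O ((x + y * sqrtC a%:R) / (x - y * sqrtC a%:R)) &
      vint l O ((x + y * sqrtC a%:R) ^+ 2)].
Proof.
move=> l_pr HO Kv /dvdnP[m aE] l2a Kx Ky; set r := sqrtC _ => z0.
have l0 : (l%:R : algC) != 0 by rewrite pnatr_eq0 -lt0n prime_gt0.
have Um : vunit O m%:R.
  apply: (vunit_nat l_pr HO); rewrite coprime_sym prime_coprime //.
  by apply: contra l2a => /dvdnP[k mE]; rewrite aE mE -mulnA dvdn_mull.
have r2 : r ^+ 2 = m%:R * l%:R by rewrite sqrtCK aE natrM.
have [m0 _ _] := Um.
have r0 : r != 0 by rewrite -sqrf_eq0 r2 mulf_neq0.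
have Vr2 : vint l O (r ^+ 2).
  by exists (-1); rewrite exprN1 r2 mulfK.
have Vsqr z : K z -> z != 0 -> vint l O (z ^+ 2).
  by move=> Kz z1; rewrite expr2; apply: vintM => //; apply: Kv.
have U1 := vunit1 HO.
have [y0|y0] := eqVneq y 0.
  rewrite y0 mul0r subr0 addr0 in z0 *.
  by split=> //; [rewrite divff|apply: Vsqr].
have [x0|x0] := eqVneq x 0.
  rewrite x0 sub0r add0r in z0 *; rewrite oppr_eq0; split=> //.
    by rewrite invrN mulrN divff //; apply: (vunitN HO).
  by rewrite exprMn; apply: vintM => //; apply: Vsqr.
pose q := x / (y * r).
have q0 : q != 0 by rewrite !mulf_neq0 ?invr_eq0 ?mulf_neq0.
have nUq : ~ vunit O q.
  move=> Uq; have [i Ui] := Kv _ Kx x0; have [j Uj] := Kv _ Ky y0.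
  have : vunit O (l%:R ^ (i + i - (j + j) + 1)).
    have -> : (l%:R : algC) ^ (i + i - (j + j) + 1) =
        (x * l%:R ^ i) * (x * l%:R ^ i) / ((y * l%:R ^ j) * (y * l%:R ^ j)) / (m%:R * (q * q)).
      have li := place_expz_neq0 i l_pr; have lj := place_expz_neq0 j l_pr.
      rewrite !expfzDr // -invr_expz expfzDr // expr1z.
      have -> : m%:R = r ^+ 2 / l%:R by rewrite r2 mulfK.
      by rewrite /q; field; rewrite ?x0 ?y0 ?r0 ?l0 ?li ?lj.
    apply: (vunitM HO); last by apply: vunitV; apply: (vunitM HO) => //; apply: (vunitM HO).
    by apply: (vunitM HO); [|apply: vunitV]; apply: (vunitM HO).
  move/(vunit_expz l_pr HO) => /eqP.
  have -> : i + i - (j + j) + 1 = (i - j) * 2 + 1 by ring.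
  move=> /eqP /(congr1 (modz^~ 2)); rewrite modzMDl.
  by [].
have [_ _ /(_ q)[Oq|Oq']] := HO.
  have [Up Um'] := vunit_1pm HO Oq nUq.
  have zE : x + y * r = y * r * (1 + q) by rewrite /q; field; rewrite r0 y0.
  have zE' : x - y * r = - (y * r * (1 - q)) by rewrite /q; field; rewrite r0 y0.
  have [p0 _ _] := Up; have [p0' _ _] := Um'; rewrite zE zE'; split.
  - by rewrite oppr_eq0 !mulf_neq0.
  - have -> : y * r * (1 + q) / - (y * r * (1 - q)) = - ((1 + q) / (1 - q)).
      by field; rewrite r0 y0 p0'.
    by apply: (vunitN HO); apply: (vunitM HO) => //; apply: vunitV.
  - rewrite !exprMn; apply: vintM => //; last by apply/vint_vunit/(vunitM HO).
    by apply: vintM => //; apply: Vsqr.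
have nUq' : ~ vunit O q^-1 by move/vunitV; rewrite invrK.
have [Up Um'] := vunit_1pm HO Oq' nUq'.
have zE : x + y * r = x * (1 + q^-1) by rewrite /q; field; rewrite x0 r0 y0.
have zE' : x - y * r = x * (1 - q^-1) by rewrite /q; field; rewrite x0 r0 y0.
have [p0 _ _] := Up; have [p0' _ _] := Um'; rewrite zE zE'; split.
- by rewrite mulf_neq0.
- have -> : x * (1 + q^-1) / (x * (1 - q^-1)) = (1 + q^-1) / (1 - q^-1).
    by rewrite -mulf_div divff // mul1r.
  by apply: (vunitM HO) => //; apply: vunitV.
- rewrite exprMn; apply: vintM => //; last by apply/vint_vunit/(vunitM HO).
  exact: Vsqr.
Qed.

(** * Multiquadratic fields *)

(** The tower form gives each element coordinates over the field of the shorter list, for inductions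
    on the list; [multiquadE] identifies it with the given field. *)
Fixpoint mq (s : seq nat) (x : algC) : Prop :=
  if s is a :: s' then
    exists u v, [/\ mq s' u, mq s' v & x = u + v * sqrtC a%:R]
  else x \in Crat.

Lemma mq_subfield s : is_subfield (mq s).
Proof.
elim: s => [|a s IH] /=.
  split; first by rewrite rpred0 rpred1.
  - by move=> x y; apply: rpredD.
  - by move=> x; rewrite rpredN.
  - by move=> x y; apply: rpredM.
  - by move=> x; rewrite rpredV.
have [[K0 K1] KD KN KM KV] := IH; set r := sqrtC _.
have r2 : r ^+ 2 = a%:R by rewrite sqrtCK.
have Ka := subfield_nat a IH.
split; first by split; [exists 0, 0|exists 1, 0]; split=> //; ring.
- move=> _ _ [u [v [Ku Kv ->]]] [u' [v' [Ku' Kv' ->]]].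
  by exists (u + u'), (v + v'); split; [apply: KD|apply: KD|ring].
- by move=> _ [u [v [Ku Kv ->]]]; exists (- u), (- v); split; [apply: KN|apply: KN|ring].
- move=> _ _ [u [v [Ku Kv ->]]] [u' [v' [Ku' Kv' ->]]].
  exists (u * u' + v * v' * a%:R), (u * v' + v * u'); split.
  + by apply: KD; [apply: (KM)|do 2![apply: (KM) => //]].
  + by apply: KD; apply: KM.
  + by rewrite -r2; ring.
- move=> _ [u [v [Ku Kv ->]]].
  have KN' : mq s (u * u - v * v * a%:R).
    by apply: subfield_sub => //; [apply: (KM)|do 2![apply: (KM) => //]].
  have NE : u * u - v * v * a%:R = (u + v * r) * (u - v * r) by rewrite -r2; ring.
  have [z0|z0] := eqVneq (u + v * r) 0.
    by exists 0, 0; split=> //; rewrite z0 invr0; ring.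
  (* The conjugate of a nonzero element can vanish here, when r already lies in the smaller field;
     the element is then 2 u. *)
  have [z'0|z'0] := eqVneq (u - v * r) 0.
    exists (2 * u)^-1, 0; split=> //; first by apply/KV/KM => //; apply: subfield_nat.
    have -> : v * r = u by apply/esym/eqP; rewrite -subr_eq0 z'0.
    by rewrite mul0r addr0 mulrDl mul1r.
  exists (u / (u * u - v * v * a%:R)), (- v / (u * u - v * v * a%:R)); split.
  + exact: subfield_div.
  + by apply: subfield_div => //; apply: KN.
  + by rewrite NE; field; rewrite z0 z'0.
Qed.

Lemma mq_sqrtC s a : a \in s -> mq s (sqrtC a%:R).
Proof.
elim: s => // b s IH; rewrite inE => /orP[/eqP ->|/IH Ka] /=.
  by have [[K0 K1] _ _ _ _] := mq_subfield s; exists 0, 1; split=> //; ring.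
by have [[K0 _] _ _ _ _] := mq_subfield s; exists (sqrtC a%:R), 0; split=> //; ring.
Qed.

Lemma mq_cons s a x : mq s x -> mq (a :: s) x.
Proof.
move=> Kx; have [[K0 _] _ _ _ _] := mq_subfield s.
by exists x, 0; split=> //; ring.
Qed.

Lemma subfield_rat F x : is_subfield F -> x \in Crat -> F x.
Proof.
move=> HF /CratP[q ->]; have [_ _ FN _ _] := HF; rewrite /ratr.
have Fi (z : int) : F z%:~R.
  by case: z => n; rewrite ?NegzE ?mulrNz; [|apply: FN]; apply: subfield_nat.
exact: subfield_div.
Qed.

Lemma mq_min s F x : is_subfield F -> (forall a, a \in s -> F (sqrtC a%:R)) -> mq s x -> F x.
Proof.
move=> HF; have [_ FD _ FM _] := HF; elim: s x => [|a s IH] x Fs.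
  exact: subfield_rat.
move=> [u [v [Ku Kv ->]]]; have IHs y : mq s y -> F y.
  by apply: IH => b bs; apply: Fs; rewrite inE bs orbT.
by apply: FD; [apply: IHs|apply: FM; [apply: IHs|apply: Fs; rewrite mem_head]].
Qed.

Lemma multiquadE n (a : 'I_n -> nat) x : multiquad a x <-> mq (codom a) x.
Proof.
split=> [Kx|Kx F HF Fa].
  by apply: Kx => [|i]; [apply: mq_subfield|apply: mq_sqrtC; apply: codom_f].
by apply: (mq_min HF) Kx => _ /codomP[i ->].
Qed.

Lemma aut_sqrtC_nat (nu : {rmorphism algC -> algC}) n :
  nu (sqrtC n%:R) = sqrtC n%:R \/ nu (sqrtC n%:R) = - sqrtC n%:R.
Proof.
have /eqP : nu (sqrtC n%:R) ^+ 2 = sqrtC n%:R ^+ 2 by rewrite -rmorphXn sqrtCK rmorph_nat.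
by rewrite eqf_sqr => /orP[] /eqP; [left|right].
Qed.

Lemma aut_mq (nu : {rmorphism algC -> algC}) s x : mq s x -> mq s (nu x).
Proof.
elim: s x => [|a s IH] x /=; first by rewrite Crat_aut.
move=> [u [v [/IH Ku /IH Kv ->]]]; rewrite rmorphD rmorphM /=.
have [_ _ KN _ _] := mq_subfield s.
case: (aut_sqrtC_nat nu a) => ->; first by exists (nu u), (nu v).
by exists (nu u), (- nu v); split=> //; [apply: KN|ring].
Qed.

Lemma aut_mq_eq (nu mu : {rmorphism algC -> algC}) s x :
  (forall a, a \in s -> nu (sqrtC a%:R) = mu (sqrtC a%:R)) -> mq s x -> nu x = mu x.
Proof.
elim: s x => [|a s IH] x eqs /=; first by move=> Kx; rewrite !aut_Crat.
move=> [u [v [Ku Kv ->]]]; rewrite !rmorphD !rmorphM /= eqs ?mem_head //.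
by rewrite !(IH _ _ Ku) ?(IH _ _ Kv) // => b bs; apply: eqs; rewrite inE bs orbT.
Qed.

(** This makes (1 + sqrt a) / 2 integral, which is what keeps 2 unramified. *)
Lemma modn4_eq1 a : (0 < a)%N -> (forall p, prime p -> p %| a -> p %% 4 = 1)%N -> (a %% 4 = 1)%N.
Proof.
elim/ltn_ind: a => a IH a0 Pa; case: (ltnP 1 a) => [a1|]; last by case: a a0 {IH Pa} => [|[]].
have pr := pdiv_prime a1; have dv := pdiv_dvd a.
have q0 : (0 < a %/ pdiv a)%N by rewrite divn_gt0 ?pdiv_gt0 // dvdn_leq.
rewrite -(divnK dv) -modnMm (IH _ _ q0) ?(Pa _ pr dv) //.
  by rewrite ltn_Pdiv // prime_gt1.
by move=> p p_pr pd; apply: Pa => //; apply: dvdn_trans pd (dvdn_div dv).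
Qed.

(** * Ramification in multiquadratic fields *)

Definition admissible (s : seq nat) : Prop :=
  (forall a, a \in s ->
     [/\ (1 < a)%N, squarefree_nat a & forall p, prime p -> p %| a -> p %% 4 = 1]%N) /\
  pairwise coprime s.

Definition ramified (l : nat) (s : seq nat) : bool := has (dvdn l) s.

Lemma admissible_cons a s : admissible (a :: s) ->
  admissible s /\ (forall b, b \in s -> coprime a b).
Proof.
move=> [Ps /= /andP[/allP co ps]]; split=> //; split=> // b bs.
by apply: Ps; rewrite inE bs orbT.
Qed.

Lemma admissible_head a s : admissible (a :: s) ->
  [/\ (1 < a)%N, squarefree_nat a & (a %% 4 = 1)%N].
Proof.
move=> [/(_ a (mem_head _ _)) [a1 sqf pr4] _]; split=> //.
by apply: modn4_eq1 => //; apply: ltnW.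
Qed.

Lemma admissible_unram a s l : admissible (a :: s) -> prime l -> (l %| a)%N -> ~~ ramified l s.
Proof.
move=> /admissible_cons[_ co] l_pr la; apply/hasPn => b /co; apply: contraL => lb.
apply/negP => /eqP cab; move: (dvdn_gcd l a b); rewrite la lb cab dvdn1 => /eqP E.
by rewrite E in l_pr.
Qed.

Lemma vint_nat l O m : prime l -> is_place l O -> (0 < m)%N -> vint l O m%:R.
Proof.
move=> l_pr HO m0; have l0 : (l%:R : algC) != 0 by rewrite pnatr_eq0 -lt0n prime_gt0.
have [k co mE] := pfactor_coprime l_pr m0.
exists (- (logn l m)%:Z); rewrite {1}mE natrM natrX -exprnN mulfK ?expf_neq0 //.
by apply: (vunit_nat l_pr HO); rewrite coprime_sym.
Qed.

Lemma vint_rat l O x : prime l -> is_place l O -> x \in Crat -> x != 0 -> vint l O x.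
Proof.
move=> l_pr HO /CratP[q ->]; rewrite fmorph_eq0 => q0; rewrite /ratr.
have vi (z : int) : z != 0 -> vint l O z%:~R.
  rewrite -absz_gt0 => z0; have := vint_nat l_pr HO z0; case: z {z0} => n //.
  rewrite NegzE mulrNz abszN /= => -[k Uk]; exists k; rewrite mulNr.
  exact: (vunitN HO).
by apply: (vintM l_pr HO); [apply: vi; rewrite numq_eq0|apply/vintV/vi/denq_neq0].
Qed.

(** The field is unramified at l: by [unramified_step], every element of a layer is a unit times an
    element of the layer below, down to the rationals. *)
Lemma mq_vint l O s x : admissible s -> prime l -> is_place l O -> ~~ ramified l s ->
  mq s x -> x != 0 -> vint l O x.
Proof.
move=> + l_pr HO; elim: s x => [|a s IH] x adm /=; first by move=> _; apply: vint_rat.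
rewrite negb_or => /andP[la ls] [u [v [Ku Kv ->]]] z0.
have [adm' _] := admissible_cons adm; have [_ _ a4] := admissible_head adm.
have [z [Kz z1 U]] := unramified_step l_pr HO (mq_subfield s) la a4 Ku Kv z0.
rewrite -(divfK z1 (u + _)); apply: (vintM l_pr HO); first exact: vint_vunit.
exact: IH.
Qed.

(** Ramification indices are at most 2: by coprimality l divides at most one entry of the list, and
    the field below that layer is unramified at l. *)
Lemma mq_vint_sqr l O s x : admissible s -> prime l -> is_place l O ->
  mq s x -> x != 0 -> vint l O (x ^+ 2).
Proof.
move=> + l_pr HO; elim: s x => [|a s IH] x adm.
  by move=> Kx x0; rewrite expr2; apply: (vintM l_pr HO); apply: mq_vint Kx x0.
move=> /= [u [v [Ku Kv ->]]] z0.
have [adm' _] := admissible_cons adm; have [_ sqf a4] := admissible_head adm.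
have [la|la] := boolP (l %| a)%N.
  have Kint z : mq s z -> z != 0 -> vint l O z.
    exact/mq_vint/(admissible_unram adm).
  by have [] := ramified_step l_pr HO Kint la (sqf _ l_pr) Ku Kv z0.
have [z [Kz z1 U]] := unramified_step l_pr HO (mq_subfield s) la a4 Ku Kv z0.
rewrite -(divfK z1 (u + _)) exprMn; apply: (vintM l_pr HO); last exact: IH.
by apply: vint_vunit; rewrite expr2; apply: (vunitM HO).
Qed.

(** At a prime dividing a the field [mq s] is unramified, but sqrt a has half-integral valuation.
    Concretely, [ramified_step] at x = sqrt a and y = 1 would make x - y sqrt a = 0 nonzero. *)
Lemma sqrtC_notin_mq a s : admissible (a :: s) -> ~ mq s (sqrtC a%:R).
Proof.
move=> adm Ka; have [a1 sqf _] := admissible_head adm; have [adm' _] := admissible_cons adm.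
have l_pr := pdiv_prime a1; set l := pdiv a in l_pr; have la : (l %| a)%N := pdiv_dvd a.
have [O HO] := place_exists (prime_gt1 l_pr).
have r0 : sqrtC a%:R != 0 :> algC by rewrite sqrtC_eq0 pnatr_eq0 -lt0n ltnW.
have Kint z : mq s z -> z != 0 -> vint l O z.
  exact/mq_vint/(admissible_unram adm).
have [[_ K1] _ _ _ _] := mq_subfield s.
have [] := ramified_step l_pr HO Kint la (sqf _ l_pr) Ka K1.
  by rewrite mul1r -mulr2n mulrn_eq0.
by rewrite mul1r subrr eqxx.
Qed.

(** * Automorphisms with prescribed signs on the square roots *)

Lemma subfield_sum F (I : Type) (r : seq I) (G : I -> algC) :
  is_subfield F -> (forall i, F (G i)) -> F (\sum_(i <- r) G i).
Proof. by case=> -[F0 _] FD _ _ _ FG; apply: big_ind. Qed.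

Lemma subfield_exp F x k : is_subfield F -> F x -> F (x ^+ k).
Proof.
move=> [[_ F1] _ _ FM _] Fx; elim: k => [|k IH]; first by rewrite expr0.
by rewrite exprS; apply: FM.
Qed.

Lemma subfield_adjoin (Qs : fieldExtType rat) (QsC : {rmorphism Qs -> algC})
    (F : algC -> Prop) (rs : seq Qs) z : is_subfield F ->
  (forall y, y \in rs -> F (QsC y)) -> z \in <<1 & rs>>%VS -> F (QsC z).
Proof.
move=> HF; elim/last_ind: rs z => [|rs y IH] z Frs.
  rewrite Fadjoin_nil => /vlineP[q ->]; apply: subfield_rat => //.
  by rewrite alg_num_field fmorph_rat Crat_rat.
rewrite adjoin_rcons => /Fadjoin_polyP[p /polyOverP Kp ->].
have IHs u : u \in <<1 & rs>>%VS -> F (QsC u).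
  by apply: IH => v vs; apply: Frs; rewrite mem_rcons inE vs orbT.
rewrite -horner_map horner_coef; apply: subfield_sum => // i.
have [_ _ _ FM _] := HF; apply: FM; first by rewrite coef_map; apply: IHs.
by apply: subfield_exp => //; apply: Frs; rewrite mem_rcons mem_head.
Qed.

Lemma minPoly_sqrt (F0 : fieldType) (L : fieldExtType F0) (K : {subfield L}) x :
  x ^+ 2 \in K -> x \notin K -> minPoly K x = 'X^2 - (x ^+ 2)%:P.
Proof.
move=> Kx2 Kx; have sz : size ('X^2 - (x ^+ 2)%:P : {poly L}) = 3%N.
  by rewrite size_polyDl size_polyXn // size_polyN (leq_ltn_trans (size_polyC_leq1 _)).
have p_mon : 'X^2 - (x ^+ 2)%:P \is monic by rewrite monicXnsubC.
have dv : minPoly K x %| 'X^2 - (x ^+ 2)%:P.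
  apply: minPoly_dvdp; first by rewrite rpredB ?polyOverXn ?polyOverC.
  by rewrite /root hornerD hornerN hornerXn hornerC subrr.
apply/eqP; rewrite -eqp_monic ?monic_minPoly // -dvdp_size_eqp //.
rewrite eqn_leq dvdp_leq ?monic_neq0 //= sz size_minPoly ltnS.
by rewrite ltn_neqAle eq_sym adjoin_deg_eq1 Kx.
Qed.

(** The automorphism is built on an abstract number field generated by the square roots, where sqrt
    a may be sent to the other root of its minimal polynomial X^2 - a, and is then extended to
    [algC]. *)
Lemma flip_exists a s : admissible (a :: s) ->
  exists tau : {rmorphism algC -> algC}, tau (sqrtC a%:R) = - sqrtC a%:R /\
    forall b, b \in s -> tau (sqrtC b%:R) = sqrtC b%:R.
Proof.
move=> adm; pose rt (b : nat) : algC := sqrtC b%:R.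
have [Qs [QsC [s1]]] := num_field_exists (rcons [seq rt b | b <- s] (rt a)).
case/lastP: s1 => [|s1 x]; first by move/(congr1 size); rewrite size_rcons.
rewrite map_rcons => /rcons_inj[s1E xE] gen.
pose K : {subfield Qs} := <<1 & s1>>%AS.
have KF z : z \in K -> mq s (QsC z).
  apply: subfield_adjoin (mq_subfield s) _ => y /(map_f QsC); rewrite s1E => /mapP[b bs ->].
  exact: mq_sqrtC.
have Kx : x \notin K.
  by apply/negP => /KF; rewrite xE; apply: sqrtC_notin_mq.
have x2 : x ^+ 2 = a%:R.
  by apply: (fmorph_inj QsC); rewrite rmorphXn xE sqrtCK rmorph_nat.
have Kx2 : x ^+ 2 \in K by rewrite x2 rpred_nat.
have hom1 : kHom 1 K (\1%VF : 'End(Qs)) by rewrite kHom1.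
have rootN : root (map_poly \1%VF (minPoly K x)) (- x).
  rewrite (minPoly_sqrt Kx2 Kx) map_poly_id => [|u _]; last by rewrite id_lfunE.
  by rewrite /root hornerD hornerN hornerXn hornerC sqrrN subrr.
pose phi := kHomExtend K \1 x (- x).
have phim : monoid_morphism phi.
  apply/kHom_monoid_morphism; rewrite -gen adjoin_rcons.
  exact: (kHomExtendP (sub1v K) hom1).
pose phiM := GRing.isMonoidMorphism.Build _ _ phi phim.
pose phiRM : {rmorphism _ -> _} := HB.pack (fun_of_lfun phi) phiM.
have [nu Dnu] := extend_algC_subfield_aut QsC phiRM.
exists nu; split.
  by rewrite -[sqrtC _]xE -Dnu /= (kHomExtend_val hom1 rootN) rmorphN.
move=> b /(map_f rt); rewrite -s1E => /mapP[y ys] /esym yE.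
rewrite -[sqrtC _]yE -Dnu /= kHomExtend_id ?id_lfunE //.
exact: seqv_sub_adjoin.
Qed.

Lemma sign_aut_exists s (e : nat -> bool) : admissible s ->
  exists nu : {rmorphism algC -> algC},
    forall b, b \in s -> nu (sqrtC b%:R) = (-1) ^+ e b * sqrtC b%:R.
Proof.
elim: s => [|a s IH] adm; first by exists idfun.
have [nu nuE] := IH (admissible_cons adm).1; have [tau [tau_a tau_s]] := flip_exists adm.
have [ok|bad] := eqVneq (nu (sqrtC a%:R)) ((-1) ^+ e a * sqrtC a%:R).
  by exists nu => b; rewrite inE => /orP[/eqP ->|/nuE].
exists (nu \o tau : {rmorphism algC -> algC}) => b; rewrite inE => /orP[/eqP ->|bs] /=; last first.
  by rewrite tau_s // nuE.
rewrite tau_a rmorphN; move: bad.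
by case: (aut_sqrtC_nat nu a) => ->; case: (e a); rewrite ?expr0 ?expr1 ?mulN1r ?mul1r ?opprK ?eqxx.
Qed.

(** * Counting classes of elements modulo a relation on quotients *)

Definition classified (A Q : algC -> Prop) (N : nat) : Prop :=
  exists c : algC -> 'I_N, forall x y, A x -> A y -> c x = c y -> Q (x / y).

Lemma classified_fin (A Q : algC -> Prop) (T : finType) (c : algC -> T) :
  (forall x y, A x -> A y -> c x = c y -> Q (x / y)) -> classified A Q #|T|.
Proof.
move=> cP; exists (fun x => enum_rank (c x)) => x y Ax Ay /enum_rank_inj.
exact: cP.
Qed.

(** Index of an extension: dividing by a chosen representative of its [f]-class moves an element of
    [A] into [B]. The map [f] need not be a homomorphism. *)
Lemma classified_ext (A B Q : algC -> Prop) (X : finType) (f : algC -> X) N :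
  (forall x, A x -> x != 0) ->
  (forall x y, A x -> A y -> f x = f y -> B (x / y)) ->
  classified B Q N -> classified A Q (#|X| * N).
Proof.
move=> A0 fB [c cP].
have /choice[rho rhoP] (t : X) : exists y, (exists2 x, A x & f x = t) -> A y /\ f y = t.
  have [[x Ax fx]|no] := EM (exists2 x, A x & f x = t); first by exists x.
  by exists 0 => /no.
have rhoA x : A x -> A (rho (f x)) /\ f (rho (f x)) = f x by move=> Ax; apply: rhoP; exists x.
rewrite -[N]card_ord -card_prod.
apply: (@classified_fin _ _ _ (fun x => (f x, c (x / rho (f x))))) => x y Ax Ay [fxy].
rewrite -fxy; have [Arho frho] := rhoA _ Ax; set r := rho _ in Arho frho *.
move=> /cP; have -> : x / r / (y / r) = x / y.
  by field; rewrite !A0.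
by apply; apply: fB; rewrite // frho.
Qed.

Lemma classified_transport (A B Q Q' : algC -> Prop) (R : algC -> algC -> Prop) N :
  (forall x, B x -> exists2 y, A y & R x y) ->
  (forall x x' y y', R x y -> R x' y' -> Q (y / y') -> Q' (x / x')) ->
  classified A Q N -> classified B Q' N.
Proof.
move=> BA RQ [c cP].
have /choice[g gP] (x : algC) : exists y, B x -> A y /\ R x y.
  have [/BA[y Ay Rxy]|nB] := EM (B x); first by exists y.
  by exists 0.
exists (c \o g) => x y /gP[Ax Rx] /gP[Ay Ry] /(cP _ _ Ax Ay).
exact: RQ.
Qed.

(** * The narrow Selmer group *)

(** Evenness of the valuation normalised on the field. When l ramifies, the index is 2 and l itself
    has normalised valuation 2, so an even valuation is just an integral multiple of v(l). *)
Definition vcond (l : nat) (O : algC -> Prop) (s : seq nat) (x : algC) : Prop :=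
  if ramified l s then vint l O x else veven l O x.

Lemma vcond_div l O s x y : prime l -> is_place l O ->
  vcond l O s x -> vcond l O s y -> vcond l O s (x / y).
Proof.
rewrite /vcond; case: ifP => _ l_pr HO Vx Vy.
  by apply: (vintM l_pr HO) => //; apply: vintV.
by apply: (vevenM l_pr HO) => //; apply: vevenV.
Qed.

Lemma vcond_sqr l O s x : admissible s -> prime l -> is_place l O ->
  mq s x -> x != 0 -> vcond l O s (x ^+ 2).
Proof.
move=> adm l_pr HO Kx x0; rewrite /vcond; case: ifPn => ls; first exact: mq_vint_sqr Kx x0.
by apply: vint_sqr_veven => //; apply: mq_vint Kx x0.
Qed.

(* Elements of [mq s] that are totally positive and whose divisor is a square in [mq t];
   the places above [l] are the conjugates of the chosen place [Pl l]. *)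
Definition selmer (Pl : nat -> algC -> Prop) (s t : seq nat) (x : algC) : Prop :=
  [/\ mq s x, totally_positive x &
      forall l (nu : {rmorphism algC -> algC}), prime l -> vcond l (Pl l) t (nu x)].

Definition tpos_square (s : seq nat) (x : algC) : Prop :=
  exists y, [/\ mq s y, totally_positive y & x = y ^+ 2].

Lemma totally_positive_neq0 x : totally_positive x -> x != 0.
Proof. by move=> /(_ idfun) /=; apply: lt0r_neq0. Qed.

Lemma totally_positive_mul x y : totally_positive x -> totally_positive y ->
  totally_positive (x * y).
Proof. by move=> xp yp nu; rewrite rmorphM mulr_gt0. Qed.

Lemma totally_positive_inv x : totally_positive x -> totally_positive x^-1.
Proof. by move=> xp nu; rewrite fmorphV invr_gt0. Qed.

Lemma totally_positive_add x y : totally_positive x -> totally_positive y ->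
  totally_positive (x + y).
Proof. by move=> xp yp nu; rewrite rmorphD addr_gt0. Qed.

Lemma totally_positive_aut (nu : {rmorphism algC -> algC}) x :
  totally_positive x -> totally_positive (nu x).
Proof. by move=> xp mu; apply: (xp (mu \o nu : {rmorphism algC -> algC})). Qed.

Lemma selmer_div Pl s t x y : (forall l, prime l -> is_place l (Pl l)) ->
  selmer Pl s t x -> selmer Pl s t y -> selmer Pl s t (x / y).
Proof.
move=> HPl [Kx xp xv] [Ky yp yv]; split.
- exact: subfield_div (mq_subfield s) _ _.
- by apply: totally_positive_mul => //; apply: totally_positive_inv.
- by move=> l nu l_pr; rewrite fmorph_div; apply: vcond_div; auto.
Qed.

(** One summand for each part of the bound: the norm, the parities at the pairs of a prime divisor
    of a and a sign pattern on the remaining square roots, and the elements of the smaller field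
    that survive. *)
Fixpoint selmer_rank (s : seq nat) : nat :=
  if s is a :: s' then
    (selmer_rank s' + (omega a * 2 ^ size s' + selmer_rank s'))%N
  else 0%N.

Lemma flip_mq (tau : {rmorphism algC -> algC}) s x :
  (forall b, b \in s -> tau (sqrtC b%:R) = sqrtC b%:R) -> mq s x -> tau x = x.
Proof. by move=> tau_s; apply: (aut_mq_eq (mu := idfun)). Qed.

(** Only the primes dividing a need care, because the condition is stronger over [mq s], which is
    unramified there. At such a prime [x / tau x] is a unit, so the norm is a unit times the square
    of [tau x], whose valuation is integral. *)
Lemma selmer_norm Pl a s (tau : {rmorphism algC -> algC}) x :
  (forall l, prime l -> is_place l (Pl l)) -> admissible (a :: s) ->
  tau (sqrtC a%:R) = - sqrtC a%:R ->
  (forall b, b \in s -> tau (sqrtC b%:R) = sqrtC b%:R) ->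
  selmer Pl (a :: s) (a :: s) x -> selmer Pl s s (x * tau x).
Proof.
move=> HPl adm tau_a tau_s [[u [v [Ku Kv xE]]] xp xv].
have [_ sqf _] := admissible_head adm; have HK := mq_subfield s.
have [_ KD KN KM _] := HK.
have tauE : tau x = u - v * sqrtC a%:R.
  by rewrite xE rmorphD rmorphM /= tau_a !(flip_mq tau_s) // mulrN.
split.
- rewrite tauE xE; set r := sqrtC _.
  have -> : (u + v * r) * (u - v * r) = u * u - v * v * r ^+ 2 by ring.
  rewrite sqrtCK; apply: subfield_sub => //; first exact: KM.
  by apply: (KM); [apply: KM|apply: subfield_nat].
- by apply: totally_positive_mul => //; apply: totally_positive_aut.
move=> l nu l_pr; have HO := HPl _ l_pr; rewrite rmorphM.
have vx := xv l nu l_pr; have := xv l (nu \o tau : {rmorphism algC -> algC}) l_pr.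
move: vx; rewrite /vcond /=.
have [la|la] /= := boolP (l %| a)%N; last first.
  by case: (ramified l s) => ? ?; [apply: vintM|apply: vevenM].
rewrite (negPf (admissible_unram adm l_pr la)) => Vx Vtx.
have Kint z : mq s z -> z != 0 -> vint l (Pl l) z.
  exact/(mq_vint (admissible_cons adm).1)/(admissible_unram adm).
have [w [Kw xw txw]] : exists w, [/\ mq s w, nu x = nu u + w * sqrtC a%:R &
    nu (tau x) = nu u - w * sqrtC a%:R].
  rewrite tauE xE rmorphB rmorphD rmorphM /=.
  case: (aut_sqrtC_nat nu a) => ->; first by exists (nu v); split=> //; apply: aut_mq.
  by exists (- nu v); split; [apply/KN/aut_mq|ring|ring].
have nux0 : nu u + w * sqrtC a%:R != 0.
  by rewrite -xw fmorph_eq0 totally_positive_neq0.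
have [tx0 U _] := ramified_step l_pr HO Kint la (sqf _ l_pr) (aut_mq nu Ku) Kw nux0.
rewrite -xw -txw in tx0 U.
have -> : nu x * nu (tau x) = nu x / nu (tau x) * nu (tau x) ^+ 2 by field.
by apply: vevenM => //; [apply: veven_vunit|apply: vint_sqr_veven].
Qed.

(* If [x * tau x = m ^ 2] then [x * (x + tau x + 2 m) = (x + m) ^ 2]. *)
Lemma selmer_norm_square Pl a s (tau : {rmorphism algC -> algC}) x :
  (forall l, prime l -> is_place l (Pl l)) -> admissible (a :: s) ->
  tau (sqrtC a%:R) = - sqrtC a%:R ->
  (forall b, b \in s -> tau (sqrtC b%:R) = sqrtC b%:R) ->
  selmer Pl (a :: s) (a :: s) x -> tpos_square s (x * tau x) ->
  exists2 r, selmer Pl s (a :: s) r & tpos_square (a :: s) (x * r).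
Proof.
move=> HPl adm tau_a tau_s [Kx xp xv] [m [Km mp Nx]].
have HK := mq_subfield s; have [_ KD KN KM _] := HK.
have [_ LD _ _ _] := mq_subfield (a :: s).
have x0 := totally_positive_neq0 xp.
pose r := x + tau x + 2 * m.
have Lg : mq (a :: s) (x + m) by apply: LD => //; apply: mq_cons.
have gp : totally_positive (x + m) by apply: totally_positive_add.
have xr : x * r = (x + m) ^+ 2.
  by rewrite /r sqrrD -Nx; ring.
exists r; last by exists (x + m).
split.
- have [u [v [Ku Kv xE]]] := Kx.
  have -> : r = 2 * (u + m).
    by rewrite /r xE rmorphD rmorphM /= tau_a !(flip_mq tau_s) //; ring.
  by apply: (KM); [apply: subfield_nat|apply: KD].
- have txp := totally_positive_aut tau xp.
  apply: totally_positive_add; first exact: totally_positive_add.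
  by rewrite mulrDl mul1r; apply: totally_positive_add.
- move=> l nu l_pr; have HO := HPl _ l_pr.
  have -> : nu r = nu (x + m) ^+ 2 / nu x.
    by rewrite -rmorphXn -xr rmorphM mulrAC divff ?mul1r // fmorph_eq0.
  apply: vcond_div => //; last exact: xv.
  by apply: vcond_sqr => //; [apply: aut_mq|rewrite fmorph_eq0 totally_positive_neq0].
Qed.

(** Over [mq s] the valuations at primes dividing a are integral, so equal parities cancel in a
    quotient. An automorphism acts on [mq s] through its signs on the square roots, so finitely many
    conjugates of [Pl l] cover all places. *)
Lemma selmer_parity Pl a s : (forall l, prime l -> is_place l (Pl l)) -> admissible (a :: s) ->
  exists f : algC -> {ffun 'I_(omega a) * (size s).-tuple bool -> bool},
    forall x y, selmer Pl s (a :: s) x -> selmer Pl s (a :: s) y -> f x = f y ->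
      selmer Pl s s (x / y).
Proof.
move=> HPl adm; have [adm' _] := admissible_cons adm; have [a1 _ _] := admissible_head adm.
have /choice[nu nuP] (e : (size s).-tuple bool) : exists nu : {rmorphism algC -> algC},
    forall b, b \in s -> nu (sqrtC b%:R) = (-1) ^+ (nth false e (index b s)) * sqrtC b%:R.
  exact: (@sign_aut_exists s (fun b => nth false e (index b s))).
pose lp (i : 'I_(omega a)) := nth 0%N (primes a) i.
exists (fun x => [ffun ie => `[< veven (lp ie.1) (Pl (lp ie.1)) (nu ie.2 x) >]]) => x y Sx Sy fxy.
have [Kxy xyp xyv] := selmer_div HPl Sx Sy; split=> // l mu l_pr; have HO := HPl _ l_pr.
have := xyv l mu l_pr; rewrite /vcond /=; have [la|//] /= := boolP (l %| a)%N.
rewrite (negPf (admissible_unram adm l_pr la)) => _.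
have l_in : l \in primes a by rewrite mem_primes l_pr la ltnW.
have li : (index l (primes a) < omega a)%N by rewrite index_mem.
pose e : (size s).-tuple bool := 
  map_tuple (fun b : nat => mu (sqrtC b%:R) != sqrtC b%:R) (in_tuple s).
have mu_nu z : mq s z -> mu z = nu e z.
  apply: aut_mq_eq => b bs; rewrite nuP // (nth_map 0%N) ?index_mem // nth_index //.
  case: (aut_sqrtC_nat mu b) => ->; first by rewrite eqxx mul1r.
  case: eqP => [->|_]; last by rewrite mulN1r.
  by rewrite mul1r.
have [[Kx xp xv] [Ky yp yv]] := (Sx, Sy).
have vi z : mq s z -> totally_positive z -> vint l (Pl l) (mu z).
  move=> Kz zp; apply: (mq_vint adm' l_pr HO (admissible_unram adm l_pr la)).
    exact: aut_mq.
  by rewrite fmorph_eq0 totally_positive_neq0.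
have lE : lp (Ordinal li) = l by rewrite /lp /= nth_index.
move/ffunP/(_ (Ordinal li, e)): fxy; rewrite !ffunE /= lE -!mu_nu // => eqb.
have ev : veven l (Pl l) (mu x) <-> veven l (Pl l) (mu y).
  by split=> /asboolP; [rewrite eqb|rewrite -eqb] => /asboolP.
rewrite fmorph_div; have [ex|ox] := EM (veven l (Pl l) (mu x)).
  by apply: vevenM => //; apply: vevenV; apply/ev.
apply: vint_odd_mul => //; [exact: vi|by apply: vintV; exact: vi|].
by move/vevenV; rewrite invrK => /ev.
Qed.

Lemma nat_even_square m (P : nat -> algC -> Prop) : (0 < m)%N ->
  (forall l, prime l -> is_place l (P l)) ->
  (forall l, prime l -> veven l (P l) m%:R) -> exists k, m = (k ^ 2)%N.
Proof.
move=> + HP; elim/ltn_ind: m => m IH m0 ev.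
case: (ltnP 1 m) => [m1|]; last by case: m m0 {IH ev} => [|[]] // _ _; exists 1%N.
have l_pr := pdiv_prime m1; set l := pdiv m in l_pr; have HO := HP _ l_pr.
have l0 : (l%:R : algC) != 0 by rewrite pnatr_eq0 -lt0n prime_gt0.
have /dvdnP[k kE] := pdiv_dvd m; rewrite -/l in kE.
have k0 : (0 < k)%N by case: k kE m0 => // ->.
have [/dvdnP[j jE]|lk] := boolP (l %| k)%N.
  have mE : m = (j * l ^ 2)%N by rewrite kE jE -mulnA.
  have j0 : (0 < j)%N by case: j jE k0 {mE} => // ->.
  have [|//|p p_pr|i iE] := IH j.
  - by rewrite mE ltn_Pmulr // (ltn_exp2l 0) // prime_gt1.
  - have HOp := HP _ p_pr.
    have -> : (j%:R : algC) = m%:R / l%:R ^+ 2 by rewrite mE natrM natrX mulfK // expf_neq0.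
    apply: vevenM => //; first exact: ev.
    by apply/vevenV/vint_sqr_veven => //; apply: vint_nat => //; apply: prime_gt0.
  - by exists (i * l)%N; rewrite mE iE expnMn.
have [z Uz] := ev _ l_pr.
have Uk : vunit (P l) k%:R by apply: (vunit_nat l_pr HO); rewrite coprime_sym prime_coprime.
have [kn0 _ _] := Uk.
have : vunit (P l) (l%:R ^ (1 + (z + z))).
  have -> : (l%:R : algC) ^ (1 + (z + z)) = k%:R^-1 * (m%:R * l%:R ^ (z + z)).
    by rewrite expfzDr // expr1z kE natrM; field.
  by apply: (vunitM HO) => //; apply: vunitV.
move/(vunit_expz l_pr HO) => E; exfalso.
have : (z * 2 + 1) = 0 by rewrite -E; ring.
by move/(congr1 (modz^~ 2)); rewrite modzMDl.
Qed.

Lemma selmer_rat_square Pl x : (forall l, prime l -> is_place l (Pl l)) ->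
  selmer Pl [::] [::] x -> tpos_square [::] x.
Proof.
move=> HPl [/= /CratP[q qE] xp xv].
have x0 := xp idfun; rewrite /= qE ltr0q in x0.
have [n nE] : exists n : nat, (0 < n)%N /\ numq q = n%:Z.
  have : 0 < numq q by rewrite numq_gt0.
  by case: (numq q) => // n n0; exists n.
have [d dE] : exists d : nat, (0 < d)%N /\ denq q = d%:Z.
  have : 0 < denq q by apply: denq_gt0.
  by case: (denq q) => // d d0; exists d.
case: nE dE => n0 nE [d0 dE].
have dn0 : (d%:R : algC) != 0 by rewrite pnatr_eq0 -lt0n.
have xE : x = n%:R / d%:R by rewrite qE /ratr nE dE.
(* The integer n d = x d^2 has the same parities as x = n / d. *)
have [||k kE] := @nat_even_square (n * d) Pl _ HPl; first by rewrite muln_gt0 n0.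
  move=> l l_pr; have HO := HPl _ l_pr.
  have -> : ((n * d)%:R : algC) = x * d%:R ^+ 2 by rewrite xE natrM; field.
  apply: vevenM => //; first exact: (xv l idfun l_pr).
  by apply: vint_sqr_veven => //; apply: vint_nat.
have k0 : (0 < k)%N.
  have : (0 < k ^ 2)%N by rewrite -kE muln_gt0 n0.
  by rewrite expn_gt0 orbF.
exists (k%:R / d%:R); split.
- by apply: (rpred_div (S := Crat)); apply: rpred_nat.
- by move=> nu; rewrite fmorph_div !rmorph_nat divr_gt0 ?ltr0n.
- by rewrite xE expr_div_n -natrX -kE natrM; field.
Qed.

Lemma selmer_classified Pl s : (forall l, prime l -> is_place l (Pl l)) -> admissible s ->
  classified (selmer Pl s s) (tpos_square s) (2 ^ selmer_rank s).
Proof.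
move=> HPl; elim: s => [|a s IH] adm.
  exists (fun _ => ord0) => x y Sx Sy _; apply: (selmer_rat_square HPl).
  exact: selmer_div.
have [c cP] := IH (admissible_cons adm).1; have [tau [tau_a tau_s]] := flip_exists adm.
have Sneq0 s' t x : selmer Pl s' t x -> x != 0 by case=> _ /totally_positive_neq0.
have [f fP] := selmer_parity HPl adm.
have cardX : #|{ffun 'I_(omega a) * (size s).-tuple bool -> bool}| =
    (2 ^ (omega a * 2 ^ size s))%N.
  by rewrite card_ffun card_prod card_tuple card_bool card_ord.
rewrite /= !expnD -{1}(card_ord (2 ^ selmer_rank s)).
(* [B] is the kernel of the norm modulo squares; below, [R] replaces its elements by elements of the
   smaller field in the same class. *)
pose B x := selmer Pl (a :: s) (a :: s) x /\ tpos_square s (x * tau x).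
apply: (@classified_ext _ B _ _ (fun x => c (x * tau x))) => [x|x y Sx Sy cxy|]; first exact: Sneq0.
  split; first exact: selmer_div.
  have := cP _ _ (selmer_norm HPl adm tau_a tau_s Sx) (selmer_norm HPl adm tau_a tau_s Sy) cxy.
  by rewrite fmorph_div mulf_div.
pose R x r := tpos_square (a :: s) (x * r) /\ selmer Pl s (a :: s) r.
apply: (@classified_transport (selmer Pl s (a :: s)) _ (tpos_square s) _ R).
- move=> x [Sx Nx]; have [r Sr xr] := selmer_norm_square HPl adm tau_a tau_s Sx Nx.
  by exists r.
- move=> x x' y y' [[g [Kg gp gE]] Sy] [[g' [Kg' gp' gE']] Sy'] [h [Kh hp hE]].
  have [y0 y'0] := (Sneq0 _ _ _ Sy, Sneq0 _ _ _ Sy').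
  have [g0 g'0] := (totally_positive_neq0 gp, totally_positive_neq0 gp').
  have h0 := totally_positive_neq0 hp.
  have HL := mq_subfield (a :: s); have [_ _ _ LM _] := HL.
  (* From x y = g^2, x' y' = g'^2 and y / y' = h^2. *)
  exists (g / (g' * h)); split.
  + by apply: subfield_div => //; apply: LM => //; apply: mq_cons.
  + by apply: totally_positive_mul => //; apply/totally_positive_inv/totally_positive_mul.
  + rewrite expr_div_n exprMn -gE -gE' -hE.
    have x'0 : x' != 0 by apply: contraTneq g'0 => x'0; rewrite -sqrf_eq0 -gE' x'0 mul0r eqxx.
    by field; rewrite x'0 y0 y'0.
rewrite -cardX; apply: (classified_ext _ fP); first by move=> x; apply: Sneq0.
by exists c.
Qed.

(** * Pell's equation *)

(* The state [(p, b, c)] is the form [p X^2 + 2 b X Y - c Y^2]; one step replaces one of the two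
   basis vectors by their sum, according to the sign of the form there (Conway's river). *)
Definition river_step (f : int * int * int) : int * int * int :=
  let: (p, b, c) := f in
  let t := p + b + b - c in
  if 0 < t then (t, b - c, c) else (p, p + b, - t).

Definition river_state (d : int) (f : int * int * int) : Prop :=
  let: (p, b, c) := f in [/\ 0 < p, 0 < c & b * b + p * c = d].

Lemma river_step_state (d : nat) f : (forall k, d <> k ^ 2)%N ->
  river_state d f -> river_state d (river_step f).
Proof.
move=> nsq; case: f => [[p b] c] [p0 c0 dE] /=.
have t0 : p + b + b - c != 0.
  apply/eqP => t0; apply: (nsq (absz (b + p))); nia.
by case: ifPn => t1; split; try nia; lia.
Qed.

(** The sign of p - 2 b - c in the new state reveals the branch taken: this number is the old p in
    the first case and minus the old c in the second. *)
Lemma river_step_inj (d : nat) f g : river_state d f -> river_state d g ->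
  (forall k, d <> k ^ 2)%N -> river_step f = river_step g -> f = g.
Proof.
case: f g => [[p b] c] [[p' b'] c'] [p0 c0 dE] [p0' c0' dE'] nsq /=.
have t0 : p + b + b - c != 0.
  apply/eqP => t0; apply: (nsq (absz (b + p))); nia.
have t0' : p' + b' + b' - c' != 0.
  apply/eqP => t1; apply: (nsq (absz (b' + p'))); nia.
case: ifPn => t1; case: ifPn => t2 [e1 e2 e3]; rewrite ?(pair_equal_spec); do ?split; try lia.
Qed.

(** There are finitely many states, as p, c and b^2 are at most d, and injectivity turns a
    repetition into a return to the start. *)
Lemma river_period (d : nat) f : (forall k, d <> k ^ 2)%N -> river_state d f ->
  exists2 k, (0 < k)%N & iter k river_step f = f.
Proof.
move=> nsq Sf; pose T : finType := ('I_d.+1 * 'I_(d + d).+1 * 'I_d.+1)%type.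
have St k g : river_state d g -> river_state d (iter k river_step g).
  by elim: k => //= k IH Sg; apply: river_step_state => //; apply: IH.
pose code (g : int * int * int) : T :=
  let: (p, b, c) := g in (inord (absz p), inord (absz (b + d%:Z)), inord (absz c)).
have code_inj g h : river_state d g -> river_state d h -> code g = code h -> g = h.
  have bound p b c : river_state d (p, b, c) ->
      [/\ 0 < p <= d, 0 < c <= d & - d%:Z <= b <= d].
    by move=> [p0 c0 dE]; split; apply/andP; split=> //; nia.
  case: g h => [[p b] c] [[p' b'] c'] /bound[p1 c1 b1] /bound[p2 c2 b2] [].
  move=> /(congr1 val) /= + /(congr1 val) /= + /(congr1 val) /=.
  rewrite !inordK; try lia.
  by move=> e1 e2 e3; congr (_, _, _); lia.
pose F (i : 'I_#|T|.+1) := code (iter i river_step f).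
have /injectivePn[i [j ij Fij]] : ~~ injectiveb F.
  by apply/negP => /injectiveP /leq_card; rewrite card_ord ltnn.
have {Fij} eij : iter i river_step f = iter j river_step f by apply: code_inj Fij; apply: St.
wlog lt_ij : i j ij eij / (i < j)%N.
  move=> W; case: (ltngtP i j) => [lt|lt|/val_inj E]; first exact: (W i j).
    by apply: (W j i) => //; rewrite eq_sym.
  by rewrite E eqxx in ij.
exists (j - i)%N; first by rewrite subn_gt0.
have {eij} : iter i river_step f = iter i river_step (iter (j - i) river_step f).
  by rewrite -iterD subnKC // ltnW.
move: (j - i)%N => m; elim: (nat_of_ord i) => [|k IH] //= E; apply: IH.
by apply: (river_step_inj _ _ nsq E); do ?apply: (St).
Qed.

Lemma pell_exists (d : nat) : (0 < d)%N -> (forall k, d <> k ^ 2)%N ->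
  exists x y : nat, (0 < y)%N /\ (x ^ 2 = d * y ^ 2 + 1)%N.
Proof.
move=> d0 nsq; have S0 : river_state d (1, 0, d%:Z) by split=> //; ring.
have [k k0 per] := river_period nsq S0.
(* The current form is X^2 - d Y^2 written in the basis (x, y), (z, w) of determinant 1. On return p
   = 1 is Pell's equation; the growth of the coordinate sum excludes the trivial solution y = 0. *)
have basis m : exists x y z w : nat, let: (p, b, c) := iter m river_step (1, 0, d%:Z) in
    [/\ p = x%:Z * x%:Z - d%:Z * (y%:Z * y%:Z), c = d%:Z * (w%:Z * w%:Z) - z%:Z * z%:Z,
        b = x%:Z * z%:Z - d%:Z * (y%:Z * w%:Z), (x * w = y * z + 1)%N &
        (m + 2 <= x + y + z + w)%N].
  elim: m => [|m [x [y [z [w IH]]]]].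
    by exists 1%N, 0%N, 0%N, 1%N; split=> //=; ring.
  rewrite iterS; case: (iter m _ _) IH => [[p b] c] [pE cE bE det sz] /=.
  case: ifPn => t0; [exists (x + z)%N, (y + w)%N, z, w|exists x, y, (x + z)%N, (y + w)%N].
    by split; rewrite ?PoszD ?pE ?cE ?bE; [ring|ring|ring|nia|nia].
  by split; rewrite ?PoszD ?pE ?cE ?bE; [ring|ring|ring|nia|nia].
have [x [y [z [w]]]] := basis k; rewrite per => -[pE cE bE det sz].
exists x, y; split; last by nia.
case: y pE cE bE det sz => [|//] pE cE bE det sz; exfalso.
have x1 : x = 1%N by nia.
subst x; have z0 : z = 0%N by lia.
by move: sz det; rewrite z0; lia.
Qed.

(** * Totally positive units *)

Definition tpunit (s : seq nat) (x : algC) : Prop :=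
  [/\ mq s x, totally_positive x, x \in Aint & x^-1 \in Aint].

Lemma tpunit1 s : tpunit s 1.
Proof.
have [[_ K1] _ _ _ _] := mq_subfield s.
by split=> //; rewrite ?invr1 ?Aint1 // => nu; rewrite rmorph1 ltr01.
Qed.

Lemma tpunitM s x y : tpunit s x -> tpunit s y -> tpunit s (x * y).
Proof.
move=> [Kx xp xA xA'] [Ky yp yA yA']; have [_ _ _ KM _] := mq_subfield s.
by split; [apply: KM|apply: totally_positive_mul|apply: rpredM|rewrite invfM; apply: rpredM].
Qed.

Lemma tpunitV s x : tpunit s x -> tpunit s x^-1.
Proof.
move=> [Kx xp xA xA']; have [_ _ _ _ KV] := mq_subfield s.
by split; rewrite ?invrK //; [apply: KV|apply: totally_positive_inv].
Qed.

Lemma tpunitX s x k : tpunit s x -> tpunit s (x ^+ k).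
Proof.
move=> Ux; elim: k => [|k IH]; first exact: tpunit1.
by rewrite exprS; apply: tpunitM.
Qed.

Lemma tpunit_prod s (I : Type) (r : seq I) (F : I -> algC) :
  (forall i, tpunit s (F i)) -> tpunit s (\prod_(i <- r) F i).
Proof. by move=> UF; apply: big_ind => //; [apply: tpunit1|apply: tpunitM]. Qed.

Lemma tpunit_aut s (nu : {rmorphism algC -> algC}) x : tpunit s x -> tpunit s (nu x).
Proof.
move=> [Kx xp xA xA']; split; rewrite -?fmorphV ?Aint_aut //.
  exact: aut_mq.
exact: totally_positive_aut.
Qed.

Lemma tpunit_gt0 s x : tpunit s x -> 0 < x.
Proof. by case=> _ /(_ idfun). Qed.

Lemma mq_fixed_rat s x : admissible s -> mq s x ->
  (forall nu : {rmorphism algC -> algC}, nu x = x) -> x \in Crat.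
Proof.
elim: s x => [|a s IH] x adm //= [u [v [Ku Kv xE]]] fix_x.
have [tau [tau_a tau_s]] := flip_exists adm.
apply: (IH _ (admissible_cons adm).1 _ fix_x); move: (fix_x tau).
rewrite xE rmorphD rmorphM /= tau_a !(flip_mq tau_s) // mulrN => /addrI/esym/eqP.
rewrite -addr_eq0 -mulr2n mulrn_eq0 /= => /eqP ->.
by rewrite addr0.
Qed.

(** * Characters and isotypic components of the unit group *)

Definition sgn_pow (b : bool) (x : algC) : algC := if b then x^-1 else x.

Lemma sgn_powM b x y : sgn_pow b (x * y) = sgn_pow b x * sgn_pow b y.
Proof. by case: b; rewrite //= invfM. Qed.

Lemma sgn_pow_addb b c x : sgn_pow b (sgn_pow c x) = sgn_pow (b (+) c) x.
Proof. by case: b; case: c; rewrite //= invrK. Qed.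

Lemma sgn_pow_aut (nu : {rmorphism algC -> algC}) b x : nu (sgn_pow b x) = sgn_pow b (nu x).
Proof. by case: b; rewrite //= fmorphV. Qed.

Lemma tpunit_sgn_pow s b x : tpunit s x -> tpunit s (sgn_pow b x).
Proof. by case: b => //; apply: tpunitV. Qed.

(** The character of the Galois group cut out by the square root of the product of the a_i with i in
    [T], written additively. *)
Definition sgn_char n (e : {ffun 'I_n -> bool}) (T : {set 'I_n}) : bool :=
  \big[addb/false]_(i in T) e i.

Definition addf n (e e' : {ffun 'I_n -> bool}) : {ffun 'I_n -> bool} :=
  [ffun i => e i (+) e' i].

Lemma addfK n (e' : {ffun 'I_n -> bool}) : involutive (fun e => addf e e').
Proof. by move=> e; apply/ffunP => i; rewrite !ffunE addbK. Qed.

Lemma sgn_char_addf n (e e' : {ffun 'I_n -> bool}) T :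
  sgn_char (addf e e') T = sgn_char e T (+) sgn_char e' T.
Proof. by rewrite /sgn_char -big_split; apply: eq_bigr => i _; rewrite ffunE. Qed.

Lemma sgn_char_sep n (T T' : {set 'I_n}) : T != T' ->
  exists e : {ffun 'I_n -> bool}, sgn_char e T (+) sgn_char e T'.
Proof.
move=> neq; have [i iTT'] : exists i, (i \in T) (+) (i \in T').
  apply: contrapT => no; case/eqP: neq; apply/setP => i; apply/eqP.
  by rewrite -negb_add; apply/negP => h; apply: no; exists i.
exists [ffun j => j == i].
have E (S : {set 'I_n}) : sgn_char [ffun j => j == i] S = (i \in S).
  rewrite /sgn_char big_mkcond (bigD1 i) //= ffunE eqxx big1 ?addbF; first by case: (i \in S).
  by move=> j ji; rewrite ffunE (negPf ji); case: ifP.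
by rewrite !E.
Qed.

Definition sgn_auts n (a : 'I_n -> nat) (sg : {ffun 'I_n -> bool} -> {rmorphism algC -> algC}) :=
  forall e i, sg e (sqrtC (a i)%:R) = (-1) ^+ e i * sqrtC (a i)%:R.

Lemma sgn_auts_exists n (a : 'I_n -> nat) : injective a -> admissible (codom a) ->
  exists sg, sgn_auts a sg.
Proof.
move=> inj_a adm; have [|sg sgP] := @choice _ _ (fun (e : {ffun 'I_n -> bool})
    (nu : {rmorphism algC -> algC}) =>
    forall i, nu (sqrtC (a i)%:R) = (-1) ^+ e i * sqrtC (a i)%:R); last by exists sg.
move=> e; have [nu nuP] := sign_aut_exists (fun b => [exists i, e i && (a i == b)]) adm.
exists nu => i; rewrite nuP ?codom_f //; congr ((-1) ^+ nat_of_bool _ * _).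
apply/existsP/idP => [[j /andP[ej /eqP/inj_a <-]]//|ei]; by exists i; rewrite ei eqxx.
Qed.

Lemma sgn_auts_add n (a : 'I_n -> nat) sg e e' x : sgn_auts a sg -> mq (codom a) x ->
  sg e' (sg e x) = sg (addf e e') x.
Proof.
move=> sgP; pose nu : {rmorphism algC -> algC} := sg e' \o sg e.
apply: (aut_mq_eq (nu := nu)) => _ /codomP[i ->] /=.
rewrite sgP rmorphM rmorph_sign /= !sgP mulrA ffunE.
by rewrite signr_addb.
Qed.

Lemma sgn_auts_cover n (a : 'I_n -> nat) sg (nu : {rmorphism algC -> algC}) : sgn_auts a sg ->
  exists e, forall x, mq (codom a) x -> nu x = sg e x.
Proof.
move=> sgP; exists [ffun i => nu (sqrtC (a i)%:R) != sqrtC (a i)%:R] => x.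
apply: aut_mq_eq => _ /codomP[i ->]; rewrite sgP ffunE.
case: (aut_sqrtC_nat nu (a i)) => ->; first by rewrite eqxx mul1r.
by case: eqP => [->|_]; rewrite ?mul1r ?mulN1r.
Qed.

Definition eigen n (sg : {ffun 'I_n -> bool} -> {rmorphism algC -> algC}) T (x : algC) : Prop :=
  forall e, sg e x = sgn_pow (sgn_char e T) x.

Lemma eigenM n (sg : {ffun 'I_n -> bool} -> {rmorphism algC -> algC}) T x y :
  eigen sg T x -> eigen sg T y -> eigen sg T (x * y).
Proof. by move=> Ex Ey e; rewrite rmorphM /= Ex Ey sgn_powM. Qed.

Lemma eigenV n (sg : {ffun 'I_n -> bool} -> {rmorphism algC -> algC}) T x :
  eigen sg T x -> eigen sg T x^-1.
Proof. by move=> Ex e; rewrite fmorphV Ex; case: (sgn_char e T). Qed.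

Lemma eigenX n (sg : {ffun 'I_n -> bool} -> {rmorphism algC -> algC}) T x k :
  eigen sg T x -> eigen sg T (x ^+ k).
Proof.
move=> Ex; elim: k => [|k IH]; last by rewrite exprS; apply: eigenM.
by move=> e; rewrite rmorph1; case: (sgn_char e T); rewrite /= ?invr1.
Qed.

(* Isotypic projection for the character [T], scaled by the order [2 ^ n] of the group. *)
Definition proj n (sg : {ffun 'I_n -> bool} -> {rmorphism algC -> algC}) T (x : algC) : algC :=
  \prod_(e : {ffun 'I_n -> bool}) sgn_pow (sgn_char e T) (sg e x).

Lemma projM n (sg : {ffun 'I_n -> bool} -> {rmorphism algC -> algC}) T x y :
  proj sg T (x * y) = proj sg T x * proj sg T y.
Proof. by rewrite /proj -big_split; apply: eq_bigr => e _ /=; rewrite rmorphM sgn_powM. Qed.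

Lemma proj1 n (sg : {ffun 'I_n -> bool} -> {rmorphism algC -> algC}) T : proj sg T 1 = 1.
Proof. by rewrite /proj big1 // => e _; rewrite rmorph1; case: sgn_char; rewrite /= ?invr1. Qed.

Lemma projX n (sg : {ffun 'I_n -> bool} -> {rmorphism algC -> algC}) T x k :
  proj sg T (x ^+ k) = proj sg T x ^+ k.
Proof. by elim: k => [|k IH]; rewrite ?proj1 // !exprS projM IH. Qed.

Lemma proj_tpunit n (sg : {ffun 'I_n -> bool} -> {rmorphism algC -> algC}) T s x :
  tpunit s x -> tpunit s (proj sg T x).
Proof. by move=> Ux; apply: tpunit_prod => e; apply/tpunit_sgn_pow/tpunit_aut. Qed.

Lemma proj_is_eigen n (a : 'I_n -> nat) sg T x : sgn_auts a sg -> mq (codom a) x ->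
  eigen sg T (proj sg T x).
Proof.
move=> sgP Kx e; rewrite /proj rmorph_prod.
have -> (b : bool) : sgn_pow b (\prod_e0 sgn_pow (sgn_char e0 T) (sg e0 x)) =
    \prod_e0 sgn_pow b (sgn_pow (sgn_char e0 T) (sg e0 x)).
  by apply: (big_morph (sgn_pow b) (sgn_powM b)); case: b; rewrite /= ?invr1.
rewrite [RHS](reindex_inj (inv_inj (addfK e))); apply: eq_bigr => e0 _ /=.
rewrite sgn_pow_aut (sgn_auts_add _ _ sgP Kx) sgn_pow_addb sgn_char_addf.
by rewrite addbC addbK.
Qed.

Lemma proj_eigen n (sg : {ffun 'I_n -> bool} -> {rmorphism algC -> algC}) T x :
  eigen sg T x -> proj sg T x = x ^+ (2 ^ n).
Proof.
move=> Ex; rewrite /proj (eq_bigr (fun _ => x)); last first.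
  by move=> e _; rewrite Ex sgn_pow_addb addbb.
by rewrite prodr_const card_ffun card_bool card_ord.
Qed.

(** Translation by an element on which the two characters differ inverts every factor, so the
    product is its own inverse; positivity leaves only 1. *)
Lemma proj_eigen_neq n (sg : {ffun 'I_n -> bool} -> {rmorphism algC -> algC}) T T' x :
  T != T' -> 0 < x -> eigen sg T' x -> proj sg T x = 1.
Proof.
move=> neq x0 Ex; have [e0 e0P] := sgn_char_sep neq.
pose g e := sgn_pow (sgn_char e T (+) sgn_char e T') x.
have -> : proj sg T x = \prod_e g e.
  by apply: eq_bigr => e _; rewrite Ex sgn_pow_addb.
have g0 e : 0 < g e by rewrite /g; case: (_ (+) _); rewrite //= invr_gt0.
have P0 : 0 < \prod_e g e by apply: prodr_gt0.
have PV : \prod_e g e = (\prod_e g e)^-1.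
  rewrite {1}(reindex_inj (inv_inj (addfK e0))) -prodfV; apply: eq_bigr => e _ /=.
  rewrite /g !sgn_char_addf addbACA e0P addbT.
  by case: (_ (+) _); rewrite //= invrK.
have /eqP : (\prod_e g e) ^+ 2 = 1 ^+ 2.
  by rewrite expr1n expr2 {2}PV divff // lt0r_neq0.
by rewrite eqrXn2 ?ler01 ?ltW // => /eqP.
Qed.

Lemma eigen_trace_nat n (a : 'I_n -> nat) sg T x : admissible (codom a) -> sgn_auts a sg ->
  tpunit (codom a) x -> eigen sg T x -> exists m : nat, x + x^-1 = m%:R.
Proof.
move=> adm sgP Ux Ex; have [Kx _ xA xA'] := Ux; have x0 := tpunit_gt0 Ux.
have [_ KD _ _ KV] := mq_subfield (codom a).
have rat : x + x^-1 \in Crat.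
  apply: (mq_fixed_rat adm); first by apply: KD => //; apply: KV.
  move=> nu; have [e eP] := sgn_auts_cover nu sgP.
  rewrite rmorphD fmorphV eP // Ex; case: sgn_char => //=.
  by rewrite invrK addrC.
have : x + x^-1 \in Num.nat.
  rewrite natrEint; apply/andP; split; first by apply: Cint_rat_Aint => //; apply: rpredD.
  by rewrite addr_ge0 ?invr_ge0 // ltW.
by case/natrP => m ->; exists m.
Qed.

Lemma trace_gt2 (x : algC) : 0 < x -> x != 1 -> 2 < x + x^-1.
Proof.
move=> x0 x1; have xn0 : x != 0 by rewrite gt_eqF.
rewrite -subr_gt0; have -> : x + x^-1 - 2 = (x - 1) ^+ 2 / x by field.
rewrite divr_gt0 // lt0r sqrf_eq0 subr_eq0 x1 /= -realEsqr.
by rewrite rpredB ?rpred1 // gtr0_real.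
Qed.

(* Descent on the trace [x + 1/x], which drops under square roots. *)
Lemma eigen_nonsquare_exists n (a : 'I_n -> nat) sg T x :
  admissible (codom a) -> sgn_auts a sg ->
  tpunit (codom a) x -> eigen sg T x -> x != 1 ->
  exists y, [/\ tpunit (codom a) y, eigen sg T y &
    forall f, tpunit (codom a) f -> eigen sg T f -> y != f ^+ 2].
Proof.
move=> adm sgP Ux Ex; have [m mE] := eigen_trace_nat adm sgP Ux Ex.
elim/ltn_ind: m => m IH in x Ux Ex mE * => x1.
have [[f [Uf Ef fE]]|no] := EM (exists f, [/\ tpunit (codom a) f, eigen sg T f & x = f ^+ 2]);
  last by exists x; split=> // f Uf Ef; apply/eqP => E; apply: no; exists f.
have [k kE] := eigen_trace_nat adm sgP Uf Ef.
have f1 : f != 1 by apply: contra_neq x1 => f1; rewrite fE f1 expr1n.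
apply: (IH k _ f) => //.
have f0 : f != 0 by rewrite gt_eqF // (tpunit_gt0 Uf).
have k2 : (2 < k)%N.
  by rewrite -(ltr_nat algC) -kE; apply: trace_gt2 => //; apply: tpunit_gt0 Uf.
(* Squaring f + 1/f gives x + 1/x + 2; with k > 2 this forces k < m. *)
have : (m + 2 = k * k)%N.
  apply/eqP; rewrite -(eqr_nat algC) natrD natrM -kE -mE fE; apply/eqP; field.
  by rewrite f0.
nia.
Qed.

(** The Pell unit of the quadratic subfield attached to [T]: having norm 1, its only conjugates are
    x and 1/x, which gives both total positivity and the eigen property. *)
Lemma pell_eigen n (a : 'I_n -> nat) sg (T : {set 'I_n}) :
  (forall i, 1 < a i)%N -> (forall i, squarefree_nat (a i)) ->
  (forall i j, i != j -> coprime (a i) (a j)) -> sgn_auts a sg -> T != set0 ->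
  exists x, [/\ tpunit (codom a) x, eigen sg T x & x != 1].
Proof.
move=> a1 sqf co sgP /set0Pn[i iT]; pose d := (\prod_(j in T) a j)%N.
pose r : algC := \prod_(j in T) sqrtC (a j)%:R.
have r2 : r ^+ 2 = d%:R.
  by rewrite /r -prodrXl natr_prod; apply: eq_bigr => j _; rewrite sqrtCK.
have d0 : (0 < d)%N by apply: prodn_gt0 => j; apply: ltnW.
have nsq k : d <> (k ^ 2)%N.
  move=> dE; have l_pr := pdiv_prime (a1 i); set l := pdiv _ in l_pr.
  have la : (l %| a i)%N := pdiv_dvd _.
  have dE' : d = (a i * \prod_(j in T | j != i) a j)%N by rewrite /d (bigD1 i).
  have lk : (l %| k)%N.
    have : (l %| k ^ 2)%N by rewrite -dE dE' dvdn_mulr.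
    by rewrite Euclid_dvdX // andbT.
  have /negP[] := sqf i l l_pr.
  have : (l * l %| d)%N by rewrite dE; apply: dvdn_mul.
  rewrite dE' Gauss_dvdl // coprimeMl andbb.
  apply: (big_ind (coprime l)) => [|u v cu cv|j /andP[_ ji]]; first exact: coprimen1.
    by rewrite coprimeMr cu cv.
  by apply: (coprime_dvdl la); apply: co; rewrite eq_sym.
have [X [Y [Y0 XY]]] := pell_exists d0 nsq.
have XY' : (X%:R : algC) ^+ 2 = d%:R * Y%:R ^+ 2 + 1.
  by rewrite -!natrX XY natrD natrM.
have r0 : 0 < r by apply: prodr_gt0 => j _; rewrite sqrtC_gt0 ltr0n ltnW.
have X0 : (0 < X)%N by rewrite -(ltn_sqr) XY; lia.
pose x := X%:R + Y%:R * r; pose x' := X%:R - Y%:R * r.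
have xx' : x * x' = 1 by rewrite /x /x' mulrC -subr_sqr exprMn r2 XY'; ring.
have x1 : 1 < x.
  by rewrite /x ltr_pwDr ?mulr_gt0 ?ltr0n ?ler1n.
have x0 : 0 < x := lt_trans ltr01 x1.
have x'E : x' = x^-1 by apply: (mulfI (lt0r_neq0 x0)); rewrite xx' divff // gt_eqF.
have nu_r (nu : {rmorphism algC -> algC}) : nu r = r \/ nu r = - r.
  have /eqP : nu r ^+ 2 = r ^+ 2 by rewrite -rmorphXn r2 rmorph_nat.
  by rewrite eqf_sqr => /orP[] /eqP; [left|right].
have Kr : mq (codom a) r.
  have [[_ K1] _ _ KM _] := mq_subfield (codom a).
  by apply: big_ind => // j _; apply/mq_sqrtC/codom_f.
have rA : r \in Aint by apply: rpred_prod => j _; apply: sqrtC_nat_Aint.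
exists x; split; last by rewrite gt_eqF.
- have [_ KD _ KM _] := mq_subfield (codom a).
  split.
  + by apply: KD; [|apply: KM => //]; apply: subfield_nat; apply: mq_subfield.
  + move=> nu; rewrite rmorphD rmorphM !rmorph_nat; case: (nu_r nu) => -> //.
    by rewrite mulrN -/x' x'E invr_gt0.
  + by rewrite rpredD ?rpredM ?Aint_nat.
  + by rewrite -x'E rpredB ?rpredM ?Aint_nat.
- move=> e; have -> : sg e x = X%:R + (-1) ^+ sgn_char e T * (Y%:R * r).
    rewrite rmorphD rmorphM !rmorph_nat mulrCA; congr (_ + _ * _).
    rewrite /r rmorph_prod (eq_bigr _ (fun j _ => sgP e j)) big_split /=; congr (_ * _).
    by rewrite /sgn_char (big_morph (fun b : bool => (-1) ^+ b : algC) (signr_addb _) (erefl _)).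
  by case: sgn_char; rewrite ?expr0 ?expr1 ?mul1r ?mulN1r //= -x'E.
Qed.

(** The 2-part of d is a proper divisor of 2 ^ m; extracting the positive root of that order leaves
    an odd power of x on the left and still a square on the right. *)
Lemma odd_power_square (x w : algC) d m : 0 < x -> 0 < w -> (0 < d < 2 ^ m)%N ->
  x ^+ d = w ^+ (2 ^ m) -> exists k j, x ^+ k.*2.+1 = (w ^+ j) ^+ 2.
Proof.
move=> x0 w0 /andP[d0 dm] E; have [o co dE] := pfactor_coprime (isT : prime 2) d0.
set v := logn 2 d in dE; have o0 : (0 < o)%N by case: o dE d0 {co} => // ->.
have vm : (v < m)%N.
  by rewrite -(ltn_exp2l v m (isT : (1 < 2)%N)) (leq_ltn_trans _ dm) // dE leq_pmull.
exists o./2, (2 ^ (m - v.+1))%N.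
have oE : o./2.*2.+1 = o by rewrite -{2}(odd_double_half o) -coprime2n co.
rewrite oE -exprM -expnSr subnSK //.
apply/eqP; rewrite -(eqrXn2 (n := 2 ^ v)) ?expn_gt0 ?exprn_ge0 ?ltW // -!exprM -expnD.
by rewrite subnK ?(ltnW vm) // -dE E.
Qed.

Definition nonempty_set n := {T : {set 'I_n} | T != set0}.

Lemma card_nonempty_set n : #|{: nonempty_set n}| = (2 ^ n - 1)%N.
Proof.
rewrite card_sig; have -> : #|[pred T : {set 'I_n} | T != set0]| = #|powerset [set: 'I_n] :\ set0|.
  by apply: eq_card => T; rewrite !inE subsetT andbT.
have := cardsD1 set0 (powerset [set: 'I_n]).
by rewrite powersetE sub0set card_powerset cardsT card_ord => ->; rewrite addKn.
Qed.

(** Projection on [T] kills the other factors and multiplies the exponent of [eta T] by 2 ^ n, which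
    the n in the exponent n + m absorbs. Were i and j different at [T], a nonzero exponent below 2 ^
    m would make an odd power of [eta T], hence [eta T] itself, the square of an eigenunit. *)
Lemma eigen_products_sep n (a : 'I_n -> nat) sg (eta : {set 'I_n} -> algC) m
    (i j : {ffun nonempty_set n -> 'I_(2 ^ m)}) w :
  sgn_auts a sg ->
  (forall T, T != set0 -> [/\ tpunit (codom a) (eta T), eigen sg T (eta T) &
    forall f, tpunit (codom a) f -> eigen sg T f -> eta T != f ^+ 2]) ->
  tpunit (codom a) w ->
  (\prod_T eta (val T) ^+ i T) / (\prod_T eta (val T) ^+ j T) = w ^+ (2 ^ (n + m)) -> i = j.
Proof.
move=> sgP etaP; pose h (i : {ffun nonempty_set n -> 'I_(2 ^ m)}) := \prod_T eta (val T) ^+ i T.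
have Uh k : tpunit (codom a) (h k).
  by apply: tpunit_prod => T; apply: tpunitX; have [] := etaP _ (valP T).
have proj_h (k : {ffun nonempty_set n -> 'I_(2 ^ m)}) (T : nonempty_set n) :
    proj sg (val T) (h k) = eta (val T) ^+ (2 ^ n * k T).
  rewrite /h (big_morph (proj sg (val T)) (projM sg (val T)) (proj1 sg (val T))).
  rewrite (bigD1 T) //= big1 ?mulr1.
    by have [_ ET _] := etaP _ (valP T); rewrite projX proj_eigen // -exprM.
  move=> S neq; have [US ES _] := etaP _ (valP S).
  rewrite projX (proj_eigen_neq _ (tpunit_gt0 US) ES) ?expr1n //.
  by apply: contra_neq neq => /val_inj.
move=> Uw E; apply/ffunP => T; apply/eqP; rewrite -val_eqE /=; apply/negPn/negP => neq.
wlog lt_ji : i j w Uw E neq / (j T < i T)%N.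
  move=> W; case: (ltngtP (j T) (i T)) => [lt|lt|eqij]; last by rewrite eqij eqxx in neq.
    exact: (W i j w).
  apply: (W j i w^-1) => //; first exact: tpunitV.
    by rewrite exprVn -E invf_div.
  by rewrite eq_sym.
have [Ue Ee nsq] := etaP _ (valP T); have e0 := tpunit_gt0 Ue.
have Kw : mq (codom a) w by case: Uw.
pose p := proj sg (val T) w.
have Up : tpunit (codom a) p by apply: proj_tpunit.
have Ep : eigen sg (val T) p by apply: proj_is_eigen Kw.
have p0 := tpunit_gt0 Up.
have hE : h i = h j * w ^+ (2 ^ (n + m)).
  by rewrite -E mulrCA divff ?mulr1 // lt0r_neq0 // (tpunit_gt0 (Uh j)).
have {E} : eta (val T) ^+ (i T - j T) = p ^+ (2 ^ m).
  apply/eqP; rewrite -(eqrXn2 (n := 2 ^ n)) ?expn_gt0 ?exprn_ge0 ?ltW // -!exprM.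
  have := congr1 (proj sg (val T)) hE; rewrite projM projX !proj_h -/p => /eqP.
  rewrite -{1}(subnK (ltnW lt_ji)) mulnDr exprD mulrC.
  rewrite (inj_eq (mulfI _)) ?expf_neq0 ?lt0r_neq0 // => /eqP pE.
  by rewrite mulnC pE expnD mulnC.
have dlt : (0 < i T - j T < 2 ^ m)%N.
  by rewrite subn_gt0 lt_ji (leq_ltn_trans (leq_subr _ _)).
case/(odd_power_square e0 p0 dlt) => k [l kl].
have : eta (val T) = (p ^+ l / eta (val T) ^+ k) ^+ 2.
  rewrite expr_div_n -kl -exprM muln2 exprSr mulrAC divff ?mul1r // expf_neq0 // lt0r_neq0 //.
apply/eqP/nsq.
  by apply: tpunitM; [apply: tpunitX|apply/tpunitV/tpunitX].
by apply: eigenM; [apply: eigenX|apply/eigenV/eigenX].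
Qed.

Definition tpunit_power (s : seq nat) (N : nat) (x : algC) : Prop :=
  exists2 y, tpunit s y & x = y ^+ N.

(** Each squaring costs at most a factor q: a unit that is trivial modulo squares is classified
    through its square root. *)
Lemma tpunit_classified_pow s q k : classified (tpunit s) (tpunit_power s 2) q ->
  classified (tpunit s) (tpunit_power s (2 ^ k)) (q ^ k).
Proof.
move=> [c cP]; elim: k => [|k IH].
  exists (fun _ => ord0) => x y Ux Uy _; exists (x / y); last by rewrite expn0 expr1.
  by apply: tpunitM => //; apply: tpunitV.
have -> : (q ^ k.+1 = #|'I_q| * q ^ k)%N by rewrite card_ord expnS.
apply: (classified_ext _ cP); first by move=> x /tpunit_gt0; apply: lt0r_neq0.
apply: (@classified_transport _ _ _ _ (fun x y => x = y ^+ 2) _ _ _ IH).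
  by move=> x [y Uy xE]; exists y.
move=> x x' y y' -> -> [z Uz zE]; exists z => //.
by rewrite -expr_div_n zE -exprM expnSr.
Qed.

(** Bernoulli's inequality for 1 + 1/q, cleared of denominators; the exponent m = q ^ (n + 1) is
    large enough to beat the constant factor q ^ n. *)
Lemma growth_comparison Q q n : (forall m, Q ^ m <= q ^ (n + m))%N -> (Q <= q)%N.
Proof.
move=> le; rewrite leqNgt; apply/negP => lt.
have [q0|q0] := posnP q.
  by have := le 1%N; rewrite q0 addn1 exp0n // leqn0 expn1 => /eqP Q0; rewrite Q0 in lt.
have bern m : (q ^ m * (q + m) <= q * q.+1 ^ m)%N.
  elim: m => [|m IH]; first by rewrite !expn0 mul1n muln1 addn0.
  rewrite [in X in (_ <= X)%N]expnSr mulnA; apply: leq_trans (leq_mul IH (leqnn q.+1)).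
  by rewrite expnSr -!mulnA leq_mul2l; apply/orP; right; nia.
pose m := (q ^ n.+1)%N.
have le1 : (q.+1 ^ m <= q ^ (n + m))%N by apply: leq_trans (le m); rewrite leq_exp2r // expn_gt0 q0.
have := leq_trans (bern m) (leq_mul (leqnn q) le1).
rewrite -expnS -addSn expnD mulnC leq_pmul2r ?expn_gt0 ?q0 // -/m.
by rewrite leqNgt -addn1 addnC leq_add2r q0.
Qed.


(* The elements [\prod_T eta_T ^ i_T] with [i_T < 2 ^ m] are distinct modulo the powers of exponent
   [2 ^ (n + m)], of which there are at most [q ^ (n + m)] classes. *)
Lemma tpunit_index n (a : 'I_n -> nat) q : injective a -> admissible (codom a) ->
  (forall i, 1 < a i)%N -> (forall i, squarefree_nat (a i)) ->
  (forall i j, i != j -> coprime (a i) (a j)) ->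
  classified (tpunit (codom a)) (tpunit_power (codom a) 2) q -> (2 ^ (2 ^ n - 1) <= q)%N.
Proof.
move=> inj_a adm a1 sqf co cl; have [sg sgP] := sgn_auts_exists inj_a adm.
have /choice[eta etaP] (T : {set 'I_n}) : exists y, T != set0 ->
    [/\ tpunit (codom a) y, eigen sg T y &
      forall f, tpunit (codom a) f -> eigen sg T f -> y != f ^+ 2].
  have [T0|T0] := boolP (T != set0); last by exists 0.
  have [x [Ux Ex x1]] := pell_eigen a1 sqf co sgP T0.
  by have [y yP] := eigen_nonsquare_exists adm sgP Ux Ex x1; exists y.
apply: (@growth_comparison _ _ n) => m.
have [c cP] := tpunit_classified_pow (n + m) cl.
pose h (i : {ffun nonempty_set n -> 'I_(2 ^ m)}) := \prod_T eta (val T) ^+ i T.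
have Uh i : tpunit (codom a) (h i).
  by apply: tpunit_prod => T; apply: tpunitX; have [] := etaP _ (valP T).
have /leq_card : injective (c \o h).
  move=> i j /(cP _ _ (Uh i) (Uh j))[w Uw E].
  exact: (eigen_products_sep sgP etaP Uw E).
by rewrite card_ffun !card_ord card_nonempty_set -!expnM mulnC.
Qed.

(** * Exact index of the squares of units *)

Definition separated (A Q : algC -> Prop) (u : seq algC) : Prop :=
  (forall x, x \in u -> A x) /\
  (forall i j, (i < j < size u)%N -> ~ Q (u`_i / u`_j)).

(** A separated family of maximal length, bounded by N, meets every class. Its size thus serves both
    as an upper bound for the index, compared with the Pell units, and as a lower bound, multiplied
    by the number of ideal classes. *)
Lemma separated_classified_exists (A Q : algC -> Prop) N x0 : A x0 ->
  (forall x, A x -> x != 0) -> (forall x y, Q x -> Q y -> Q (x / y)) ->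
  classified A Q N -> exists2 u, separated A Q u & classified A Q (size u).
Proof.
move=> Ax0 A0 QV [c cP]; pose P k := `[< exists2 u, size u = k & separated A Q u >].
have P0 : exists k, P k.
  by exists 0%N; apply/asboolP; exists [::] => //; split=> // i j; rewrite andbC.
have Pmax k : P k -> (k <= N)%N.
  move=> /asboolP[u <- [Au sepu]].
  have uA (i : 'I_(size u)) : A u`_i by apply/Au/mem_nth.
  have /leq_card : injective (fun i : 'I_(size u) => c u`_i); last by rewrite !card_ord.
  move=> i j cij; case: (ltngtP i j) => [lt|lt|/val_inj //].
    by case: (sepu i j); [rewrite lt /=|apply: cP].
  by case: (sepu j i); [rewrite lt /=|apply: cP].
have [k /asboolP[u <- sepu] maxk] := ex_maxnP P0 Pmax; exists u => //.
have [Au nQ] := sepu.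
have near x : A x -> exists2 j, (j < size u)%N & Q (x / u`_j).
  move=> Ax; apply: contrapT => far.
  suff /maxk : P (size u).+1 by rewrite ltnn.
  apply/asboolP; exists (x :: u) => //; split.
    by move=> y; rewrite inE => /orP[/eqP ->|/Au].
  move=> i j /andP[]; case: j => [//|j]; case: i => [_ ju /= Qxu|i]; first by apply: far; exists j.
  by rewrite /= !ltnS => ij ju; apply: nQ; rewrite ij.
have /choice[g gP] (x : algC) : exists j : nat, A x -> (j < size u)%N /\ Q (x / u`_j).
  have [/near[j ju Qj]|nA] := EM (A x); first by exists j.
  by exists 0%N.
have u0 : (0 < size u)%N by have [j ju _] := near _ Ax0; apply: leq_ltn_trans ju.
pose d := Ordinal u0; exists (fun x => insubd d (g x)) => x y /gP[gx Qx] Ay.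
have [gy Qy] := gP _ Ay; have y0 := A0 _ Ay.
move/(congr1 val); rewrite !val_insubd gx gy => E; rewrite -E in Qy.
have uj : u`_(g x) != 0 by apply/A0/Au/mem_nth.
have -> : x / y = (x / u`_(g x)) / (y / u`_(g x)) by field; rewrite uj y0.
exact: QV.
Qed.

(** * From ideals with principal square to the Selmer group *)

Lemma ideal_mul_self (I : algC -> Prop) x y : I x -> I y -> ideal_mul I I (x * y).
Proof.
by move=> Ix Iy; exists [:: (x, y)]; split; [move=> p; rewrite inE => /eqP ->|rewrite big_seq1].
Qed.

(* Some [x] in [I] attains the minimal valuation, for otherwise [1] would be a sum of non-units. *)
Lemma square_ideal_selmer Pl s I alpha : (forall l, prime l -> is_place l (Pl l)) ->
  admissible s -> nz_ideal (mq s) I -> mq s alpha -> totally_positive alpha ->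
  (forall z, ideal_mul I I z <-> exists y, ring_of_integers (mq s) y /\ z = alpha * y) ->
  selmer Pl s s alpha.
Proof.
move=> HPl adm [IK I0 ID IM _] Ka ap I2; split=> // l nu l_pr; have HO := HPl _ l_pr.
have a0 := totally_positive_neq0 ap.
have intI x y : I x -> I y -> Pl l (nu (x * y / alpha)).
  move=> Ix Iy; have [z [[_ zA] ->]] := (I2 _).1 (ideal_mul_self Ix Iy).
  by rewrite mulrC mulKf //; apply: (place_Aint HO); rewrite Aint_aut.
have [x [Ix Ux]] : exists x, I x /\ vunit (Pl l) (nu (x * x / alpha)).
  apply: contrapT => no.
  have [[_ K1] _ _ _ _] := mq_subfield s.
  have [r [rI]] : ideal_mul I I alpha.
    by apply/I2; exists 1; rewrite mulr1; split=> //; split=> //; apply: Aint1.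
  move/(congr1 (fun z => nu (z / alpha))); rewrite divff // rmorph1 mulr_suml rmorph_sum /=.
  have : Pl l (\sum_(p <- r) nu (p.1 * p.2 / alpha)) /\
      ~ vunit (Pl l) (\sum_(p <- r) nu (p.1 * p.2 / alpha)).
    rewrite big_seq; apply: (big_ind (fun t => Pl l t /\ ~ vunit (Pl l) t)).
    - by split; [apply: (place_Aint HO) Aint0|case; rewrite eqxx].
    - move=> x y [Ox nUx] [Oy nUy]; split; first exact: (place_add HO).
      by case/(vunit_add HO Ox Oy).
    - move=> [x y] /rI[/= Ix Iy]; split; first exact: intI.
      move=> U; apply: no; exists y; split=> //.
      apply: (vunit_mulr HO (intI _ _ Ix Ix) (intI _ _ Iy Iy)).
      rewrite -rmorphM.
      have -> : x * x / alpha * (y * y / alpha) = (x * y / alpha) * (x * y / alpha) by field.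
      by rewrite rmorphM; apply: (vunitM HO).
  by move=> [_ nU] E; apply: nU; rewrite -E; apply: vunit1 HO.
have x0 : x != 0.
  by case: Ux => + _ _; apply: contraNneq => ->; rewrite !mul0r rmorph0.
have -> : nu alpha = nu x ^+ 2 / nu (x * x / alpha).
  by rewrite -rmorphXn -fmorph_div; congr (nu _); field; rewrite x0 a0.
have [Kx _] := IK _ Ix.
apply: vcond_div => //.
  by apply: vcond_sqr; rewrite ?fmorph_eq0 //; apply: aut_mq.
by rewrite /vcond; case: ifP => _; [apply: vint_vunit|apply: veven_vunit].
Qed.

(* [1] is a combination of products of elements of [I / alpha] and [I], and for [x] in [J] and
   [y] in [I] the square of [x * y / (lam * alpha)] is integral. *)
Lemma ideal_sqrt_incl K I J alpha beta lam eps x : is_subfield K -> nz_ideal K I -> nz_ideal K J ->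
  K alpha -> alpha != 0 -> K lam -> lam != 0 -> eps \in Aint ->
  (forall z, ideal_mul I I z <-> exists y, ring_of_integers K y /\ z = alpha * y) ->
  (forall z, ideal_mul J J z <-> exists y, ring_of_integers K y /\ z = beta * y) ->
  beta = eps * lam ^+ 2 * alpha -> J x -> I (x / lam).
Proof.
move=> HK [IK I0 ID IM _] [JK _ _ _ _] Ka a0 Kl l0 eA I2 J2 bE Jx.
have [[_ K1] _ _ KM _] := HK.
have [r [rI aE]] : ideal_mul I I alpha.
  by apply/I2; exists 1; rewrite mulr1; split=> //; split=> //; apply: Aint1.
have -> : x / lam = \sum_(p <- r) x * p.1 / (lam * alpha) * p.2.
  transitivity (x / (lam * alpha) * alpha); first by field; rewrite l0 a0.
  rewrite {2}aE mulr_sumr; apply: eq_bigr => p _; field; rewrite l0 a0 //.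
rewrite big_seq; apply: (big_ind I) => // -[y z] /rI[/= Iy Iz]; apply: IM => //.
have [[Kx _] [Ky _]] := (JK _ Jx, IK _ Iy); split.
  by apply: subfield_div => //; apply: KM.
have [u [[_ uA] uE]] := (I2 _).1 (ideal_mul_self Iy Iy).
have [v [[_ vA] vE]] := (J2 _).1 (ideal_mul_self Jx Jx).
apply: Aint_sqr; have -> : (x * y / (lam * alpha)) ^+ 2 = eps * u * v.
  rewrite expr_div_n [(x * y) ^+ 2]exprMn !expr2 uE vE bE; field.
  by rewrite l0 a0.
by rewrite !rpredM.
Qed.

Lemma tpunit_selmer Pl s x : (forall l, prime l -> is_place l (Pl l)) ->
  tpunit s x -> selmer Pl s s x.
Proof.
move=> HPl [Kx xp xA xA']; split=> // l nu l_pr; have HO := HPl _ l_pr.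
have U : vunit (Pl l) (nu x).
  split; first by rewrite fmorph_eq0 totally_positive_neq0.
    by apply: (place_Aint HO); rewrite Aint_aut.
  by rewrite -fmorphV; apply: (place_Aint HO); rewrite Aint_aut.
by rewrite /vcond; case: ifP => _; [apply: vint_vunit|apply: veven_vunit].
Qed.

Lemma tpunit_sqrt s x : tpunit s x -> tpos_square s x -> tpunit_power s 2 x.
Proof.
move=> [Kx xp xA xA'] [y [Ky yp xE]]; exists y => //; split=> //.
  by apply: Aint_sqr; rewrite -xE.
by apply: Aint_sqr; rewrite exprVn -xE.
Qed.

(* The products [alpha_k * u_j], with [I_k ^ 2 = (alpha_k)] and [u_j] running over the classes of
   totally positive units modulo squares, are distinct in the narrow Selmer group. *)
Lemma class_times_unit_bound Pl s m (I : 'I_m -> algC -> Prop) u :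
  (forall l, prime l -> is_place l (Pl l)) -> admissible s ->
  (forall k, nz_ideal (mq s) (I k) /\ narrow_2torsion (mq s) (I k)) ->
  (forall k l, k != l -> ~ narrow_equiv (mq s) (I k) (I l)) ->
  separated (tpunit s) (tpunit_power s 2) u ->
  (m * size u <= 2 ^ selmer_rank s)%N.
Proof.
move=> HPl adm HI neq [Uu sepu]; have HK := mq_subfield s; have [_ _ _ KM KV] := HK.
have /choice[al alP] (k : 'I_m) := (HI k).2.
have uP (j : 'I_(size u)) : tpunit s u`_j by apply/Uu/mem_nth.
have [c cP] := selmer_classified HPl adm.
have Sel k (j : 'I_(size u)) : selmer Pl s s (al k * u`_j).
  have [Kal alp I2] := alP k.
  have Sal := square_ideal_selmer HPl adm (HI k).1 Kal alp I2.
  by rewrite -[u`_j]invrK; apply: selmer_div => //; apply/tpunit_selmer/tpunitV.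
have /leq_card : injective (fun kj : 'I_m * 'I_(size u) => c (al kj.1 * u`_(kj.2))); last first.
  by rewrite card_prod !card_ord.
move=> [k j] [k' j'] /= /(cP _ _ (Sel k j) (Sel k' j'))[lam [Klam lamp E]].
have [[Kal alp I2] [Kal' alp' I2']] := (alP k, alP k').
have [[Ku up uA uA'] [Ku' up' uA2 uA2']] := (uP j, uP j').
have [a0 a0'] := (totally_positive_neq0 alp, totally_positive_neq0 alp').
have [u0 u0'] := (totally_positive_neq0 up, totally_positive_neq0 up').
have l0 := totally_positive_neq0 lamp.
have kE : k = k'.
  apply/eqP; apply: contrapT => /negP kk'; apply: (neq _ _ kk').
  exists lam^-1; split; [exact: KV|exact: totally_positive_inv|].
  (* The two generators of the squared ideals differ by the unit [eps] times a square, so the ideals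
     themselves differ by the factor 1 / lam. *)
  pose eps := u`_j / u`_j'.
  have e0 : eps != 0 by rewrite mulf_neq0 ?invr_eq0.
  have aE : al k' = eps * lam^-1 ^+ 2 * al k.
    by rewrite exprVn -E /eps; field; rewrite ?a0 ?a0' ?u0 ?u0'.
  have aE' : al k = eps^-1 * lam ^+ 2 * al k'.
    rewrite aE; field; rewrite l0 e0 //.
  have [eA eA'] : eps \in Aint /\ eps^-1 \in Aint.
    by rewrite /eps invf_div; split; apply: rpredM.
  move=> x; split=> [Jx|[y [Iy ->]]].
    exists (x / lam^-1); split; last by field.
    by apply: (ideal_sqrt_incl HK (HI k).1 (HI k').1 Kal a0 _ _ eA I2 I2' aE Jx);
      [apply: KV|rewrite invr_eq0].
  rewrite mulrC.
  exact: (ideal_sqrt_incl HK (HI k').1 (HI k).1 Kal' a0' Klam l0 eA' I2' I2 aE' Iy).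
subst k'; congr (_, _).
have Q : tpunit_power s 2 (u`_j / u`_j').
  apply: tpunit_sqrt; first by apply: tpunitM => //; apply: tpunitV.
  by exists lam; split=> //; rewrite -E; field; rewrite a0 u0'.
case: (ltngtP j j') => [lt|lt|/val_inj //]; first by case: (sepu j j' _ Q); rewrite lt /=.
case: (sepu j' j); first by rewrite lt /=.
case: Q => w Uw wE; exists w^-1; first exact: tpunitV.
by rewrite exprVn -wE invf_div.
Qed.

(** * The final count *)

Lemma omegaM a b : (0 < a)%N -> (0 < b)%N -> coprime a b ->
  omega (a * b) = (omega a + omega b)%N.
Proof.
move=> a0 b0 co; rewrite /omega -size_cat; apply/perm_size/uniq_perm.
- exact: primes_uniq.
- rewrite cat_uniq !primes_uniq andbT /=; apply/hasPn => p.
  rewrite !mem_primes => /and3P[p_pr _ pb]; apply/negP => /and3P[_ _ pa].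
  have : (p %| gcdn a b)%N by rewrite dvdn_gcd pa.
  by rewrite (eqP co) dvdn1 => /eqP E; rewrite E in p_pr.
- by move=> p; rewrite mem_cat primesM.
Qed.

Lemma omega_prod s : admissible s ->
  omega (\prod_(b <- s) b) = (\sum_(b <- s) omega b)%N.
Proof.
elim: s => [|a s IH] adm; first by rewrite !big_nil.
have [adm' co] := admissible_cons adm; have [a1 _ _] := admissible_head adm.
have pos : (0 < \prod_(b <- s) b)%N.
  rewrite big_seq; apply: prodn_cond_gt0 => b bs.
  by have [/(_ b bs)[b1 _ _] _] := adm'; apply: ltnW.
rewrite !big_cons omegaM ?IH ?(ltnW a1) //.
rewrite big_seq; apply: (big_ind (coprime a)) => // [|x y cx cy]; first exact: coprimen1.
by rewrite coprimeMr cx cy.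
Qed.

(** Closed form of the recursion, doubled so as to avoid the truncated exponent [size s - 1]. *)
Lemma selmer_rank_double s :
  ((selmer_rank s).*2 = (\sum_(b <- s) omega b) * 2 ^ size s)%N.
Proof.
elim: s => [|a s IH]; first by rewrite big_nil.
rewrite big_cons /= expnS; nia.
Qed.

Lemma codom_admissible n (a : 'I_n -> nat) : (forall i, 1 < a i)%N ->
  (forall i, squarefree_nat (a i)) -> (forall i j, i != j -> coprime (a i) (a j)) ->
  (forall i p, prime p -> p %| a i -> p %% 4 = 1)%N -> admissible (codom a).
Proof.
move=> a1 sqf co a4; split=> [_ /codomP[i ->]|]; first by split=> //; apply: a4.
rewrite /codom /image_mem pairwise_map.
have := enum_uniq 'I_n; rewrite uniq_pairwise; apply: sub_pairwise => i j.
exact: co.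
Qed.

Theorem theorem1p1 (n : nat) (a : 'I_n -> nat) :
  (0 < n)%N ->
  (forall i, 2 <= a i)%N ->
  (forall i, squarefree_nat (a i)) ->
  (forall i j, i != j -> coprime (a i) (a j)) ->
  (forall i p, prime p -> (p %| a i)%N -> p %% 4 = 1)%N ->
  dim_narrow_cl2_le (multiquad a)
    (omega (\prod_(i < n) a i) * 2 ^ (n - 1) + 1 - 2 ^ n)%N.
Proof.
move=> n0 a1 sqf co a4 m I HI neq.
have KE : multiquad a = mq (codom a) by apply/funext => x; apply/propext/multiquadE.
rewrite {}KE in HI neq.
have adm := codom_admissible a1 sqf co a4.
have inj_a : injective a.
  move=> i j E; apply/eqP; apply: contrapT => /negP /co.
  by rewrite E /coprime gcdnn => /eqP E1; have := a1 j; rewrite E1.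
have /choice[Pl HPl] (l : nat) : exists O, prime l -> is_place l O.
  have [/prime_gt1/place_exists[O HO]|_] := boolP (prime l); first by exists O.
  by exists (fun _ => True).
have [c cP] := selmer_classified HPl adm.
have cl : classified (tpunit (codom a)) (tpunit_power (codom a) 2) (2 ^ selmer_rank (codom a)).
  exists c => x y Ux Uy /(cP _ _ (tpunit_selmer HPl Ux) (tpunit_selmer HPl Uy)).
  by apply: tpunit_sqrt; apply: tpunitM => //; apply: tpunitV.
have [||u sepu clu] := separated_classified_exists (tpunit1 (codom a)) _ _ cl.
- by move=> x /tpunit_gt0; apply: lt0r_neq0.
- move=> x y [x' Ux ->] [y' Uy ->]; exists (x' / y'); last by rewrite expr_div_n.
  by apply: tpunitM => //; apply: tpunitV.
have q_ge := tpunit_index inj_a adm a1 sqf co clu.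
have bound := class_times_unit_bound HPl adm HI neq sepu.
have rk : (omega (\prod_(i < n) a i) * 2 ^ (n - 1) = selmer_rank (codom a))%N.
  apply: double_inj; rewrite selmer_rank_double -omega_prod // size_codom card_ord.
  rewrite /codom /image_mem big_map big_enum /= -muln2 -mulnA -expnSr subn1 prednK //.
(* For m > 0 the product bound itself shows 2 ^ n - 1 to be at most the Selmer rank, so the
   truncated subtraction in the exponent is a genuine one. *)
rewrite rk; have [->//|m0] := posnP m.
have le : (m * 2 ^ (2 ^ n - 1) <= 2 ^ selmer_rank (codom a))%N.
  by apply: leq_trans bound; rewrite leq_mul2l q_ge orbT.
have le1 : (2 ^ n - 1 <= selmer_rank (codom a))%N.
  by rewrite -(leq_exp2l _ _ (isT : (1 < 2)%N)) (leq_trans _ le) // leq_pmull.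
have p0 : (0 < 2 ^ n)%N by rewrite expn_gt0.
rewrite -(leq_pmul2r (m := 2 ^ (2 ^ n - 1))) ?expn_gt0 // -expnD.
by have -> : (selmer_rank (codom a) + 1 - 2 ^ n + (2 ^ n - 1) = selmer_rank (codom a))%N by lia.
Qed.
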